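(* Let $K$ be a field with $\mathrm{char}(K)\neq 2$ and let $\mathfrak{g}$ be the free Lie algebra over $K$ on the set $\{x_1,\ldots,x_m\}$. Then $\chi(\mathfrak{g})\cong \mathcal{L}\rtimes\mathfrak{g}$, where $\mathcal{L}$ is the Lie algebra given by the presentation in the context and $\mathfrak{g}$ acts on $\mathcal{L}$ by the derivations determined by $$x_s\cdot a_i=\tfrac12\big([a_s,a_i]+b_{s,i}\big),\qquad x_s\cdot b_{i,j}=\tfrac12\big([a_s,b_{i,j}]+[a_s,a_i,a_j]\big)$$ for all $s,i,j$.
   Context: Brackets are right-normed: $[y_1,y_2,\ldots,y_n]=[y_1,[y_2,\ldots,[y_{n-1},y_n]\ldots]]$. Weak commutativity: let $\mathfrak{g}^{\psi}$ be an isomorphic copy of $\mathfrak{g}$ via $x\mapsto x^{\psi}$; then $\chi(\mathfrak{g})=\langle \mathfrak{g},\mathfrak{g}^{\psi} \mid [x,x^{\psi}]=0 \text{ for all } x\in\mathfrak{g}\rangle$ (the quotient of the free product of the Lie algebras $\mathfrak{g}$ and $\mathfrak{g}^{\psi}$ by the ideal generated by all $[x,x^{\psi}]$). The Lie algebra $\mathcal{L}$: it is generated by symbols $a_i$ ($1\le i\le m$) and $b_{i,j}$ ($1\le i<j\le m$), with the conventions $b_{i,i}=0$ and $b_{j,i}=-b_{i,j}$, subject to the following relations. (R1) $[a_i,a_j,b_{k,l}]=[a_i,b_{j,k},a_l]+[a_i,a_k,b_{j,l}]$ for all $i,j,k,l\in\{1,\ldots,m\}$. (R2) For every odd integer $n\ge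 3$, all positions $1\le p<q\le n$, all indices $j,j',k,k'$, and all choices of the entries $u_i\in\{a_t,b_{s,t}\}_{s,t}$ in the remaining positions: $$[u_1,\ldots,b_{j,j'},\ldots,b_{k,k'},\ldots,u_n]=[u_1,\ldots,[a_j,a_{j'}],\ldots,[a_k,a_{k'}],\ldots,u_n],$$ where the displayed special entries are in positions $p$ and $q$ on both sides. (R3) For every odd integer $n\ge 3$, every position $1\le p\le n-2$, all indices $j,j',k,l$, and all choices of entries $u_i\in\{a_t,b_{s,t}\}_{s,t}$ in the other positions among $1,\ldots,n-2$: $$[u_1,\ldots,b_{j,j'},\ldots,u_{n-2},a_k,a_l]=[u_1,\ldots,[a_j,a_{j'}],\ldots,u_{n-2},b_{k,l}],$$ where $b_{j,j'}$, respectively $[a_j,a_{j'}]$, is in position $p$. For each $s$ the formulas in the claim define a derivation of $\mathcal{L}$, and since $\mathfrak{g}$ is free this gives an action $\mathfrak{g}\to \mathrm{Der}(\mathcal{L})$; in $\mathcal{L}\rtimes\mathfrak{g}$ one has $[x,\ell]=x\cdot\ell$ for $x\in\mathfrak{g}$, $\ell\in\mathcal{L}$. *)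

(* Defs.v *)
From HB Require Import structures.
From mathcomp Require Import all_boot all_algebra.
From mathcomp Require Import generic_quotient ring_quotient.
From mathcomp Require Import boolp.

Set Implicit Arguments.
Unset Strict Implicit.
Unset Printing Implicit Defensive.

Import GRing.Theory.
Local Open Scope ring_scope.
Local Open Scope quotient_scope.

HB.mixin Record Lmodule_isLieAlgebra (K : fieldType) L of GRing.Lmodule K L := {
  lie : L -> L -> L;
  lie_linearl : forall z : L, linear (lie^~ z);
  lie_linearr : forall z : L, linear (lie z);
  lie_alt : forall x : L, lie x x = 0;
  lie_jacobi : forall x y z : L,
    lie x (lie y z) + lie y (lie z x) + lie z (lie x y) = 0
}.

#[short(type="lieAlgType")]
HB.structure Definition LieAlgebra (K : fieldType) :=
  { L of GRing.Lmodule K L & Lmodule_isLieAlgebra K L }.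

Section LieBasics.
Variable K : fieldType.

(* rlie [:: y1; ...; yn] = lie y1 (lie y2 ... (lie y(n-1) yn)) *)
Fixpoint rlie (L : lieAlgType K) (s : seq L) : L :=
  match s with
  | [::] => 0
  | [:: y] => y
  | y :: s' => lie y (rlie s')
  end.

Lemma lieDl (L : lieAlgType K) (x y z : L) : lie (x + y) z = lie x z + lie y z.
Proof. by rewrite -[x]scale1r lie_linearl !scale1r. Qed.

Lemma lieDr (L : lieAlgType K) (x y z : L) : lie z (x + y) = lie z x + lie z y.
Proof. by rewrite -[x]scale1r lie_linearr !scale1r. Qed.

Lemma lieBl (L : lieAlgType K) (x y z : L) : lie (x - y) z = lie x z - lie y z.
Proof. by rewrite addrC -scaleN1r lie_linearl scaleN1r addrC. Qed.

Lemma lieBr (L : lieAlgType K) (x y z : L) : lie z (x - y) = lie z x - lie z y.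
Proof. by rewrite addrC -scaleN1r lie_linearr scaleN1r addrC. Qed.

Lemma lieNC (L : lieAlgType K) (x y : L) : lie x y = - lie y x.
Proof.
have := lie_alt (x + y); rewrite lieDl !lieDr !lie_alt add0r addr0 => /eqP.
by rewrite addr_eq0 => /eqP.
Qed.

Definition lie_hom (L1 L2 : lieAlgType K) (f : L1 -> L2) : Prop :=
  linear f /\ {morph f : x y / lie x y}.

Definition lie_isomorphic (L1 L2 : lieAlgType K) : Prop :=
  exists2 f : L1 -> L2, lie_hom f & bijective f.

End LieBasics.

Section Quotient.
Variables (K : fieldType) (L : lieAlgType K).

Definition lie_ideal (I : L -> Prop) : Prop :=
  [/\ I 0,
      forall x y, I x -> I y -> I (x + y),
      forall (c : K) x, I x -> I (c *: x)
    & forall x y, I y -> I (lie x y)].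

(* The ideal generated by the differences x - y with R x y. *)
Definition rel_ideal (R : L -> L -> Prop) : {pred L} :=
  fun z => `[< forall I : L -> Prop,
     lie_ideal I -> (forall x y, R x y -> I (x - y)) -> I z >].

Variable R : L -> L -> Prop.
Local Notation J := (rel_ideal R).

Lemma rel_ideal_ideal : lie_ideal (fun z => z \in J).
Proof.
split=> [|x y /asboolP hx /asboolP hy|c x /asboolP hx|x y /asboolP hy];
  apply/asboolP => I hI hR; have [I0 ID IZ IL] := hI => //.
- by apply: ID; [apply: hx|apply: hy].
- by apply: IZ; apply: hx.
- by apply: IL; apply: hy.
Qed.

Lemma rel_ideal_zmod_closed : zmod_closed J.
Proof.
have [I0 ID IZ _] := rel_ideal_ideal.
by split=> // x y hx hy; rewrite -scaleN1r; apply: ID => //; apply: IZ.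
Qed.

HB.instance Definition _ := GRing.isZmodClosed.Build L J rel_ideal_zmod_closed.

Definition lie_quot_type := Quotient.quot J.
HB.instance Definition _ := GRing.Zmodule.on lie_quot_type.

Local Notation Q := lie_quot_type.

Definition quot_pi (x : L) : Q := \pi_Q x.

Lemma quot_piP x y : reflect (quot_pi x = quot_pi y) (x - y \in J).
Proof.
by rewrite (_ : (x - y \in J) = (x == y %[mod Q])) ?Quotient.idealrBE //; apply: eqP.
Qed.

Lemma quot_pi_repr (q : Q) : quot_pi (repr q) = q.
Proof. exact: reprK. Qed.

Lemma quot_piB : {morph quot_pi : x y / x - y}.
Proof. by move=> x y; rewrite /quot_pi !piE. Qed.

Lemma quot_piD : {morph quot_pi : x y / x + y}.
Proof. by move=> x y; rewrite /quot_pi !piE. Qed.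

Definition quot_scale (c : K) (q : Q) : Q := quot_pi (c *: repr q).
Definition quot_lie (p q : Q) : Q := quot_pi (lie (repr p) (repr q)).

Lemma repr_pi_sub x : repr (quot_pi x) - x \in J.
Proof. by apply/quot_piP; rewrite quot_pi_repr. Qed.

Lemma quot_piZ c x : quot_pi (c *: x) = quot_scale c (quot_pi x).
Proof.
apply/esym/quot_piP; rewrite -scalerBr.
by have [_ _ IZ _] := rel_ideal_ideal; apply: IZ; exact: repr_pi_sub.
Qed.

Lemma quot_pi_lie x y : quot_pi (lie x y) = quot_lie (quot_pi x) (quot_pi y).
Proof.
have [_ ID IZ IL] := rel_ideal_ideal.
apply/esym/quot_piP.
have -> : lie (repr (quot_pi x)) (repr (quot_pi y)) - lie x y =
    lie (repr (quot_pi x)) (repr (quot_pi y) - y)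
    + (-1) *: lie y (repr (quot_pi x) - x).
  by rewrite scaleN1r -[- lie y _]lieNC lieBl lieBr addrA subrK.
by apply: ID; [|apply: IZ]; apply: IL; exact: repr_pi_sub.
Qed.

Lemma quot_scaleA a b v : quot_scale a (quot_scale b v) = quot_scale (a * b) v.
Proof. by rewrite -[v]quot_pi_repr -!quot_piZ scalerA. Qed.
Lemma quot_scale1 : left_id 1 quot_scale.
Proof. by move=> v; rewrite -[v]quot_pi_repr -!quot_piZ scale1r. Qed.
Lemma quot_scaleDr : right_distributive quot_scale +%R.
Proof.
move=> c p q; rewrite -[p]quot_pi_repr -[q]quot_pi_repr.
by rewrite -!(quot_piD, quot_piZ) scalerDr.
Qed.
Lemma quot_scaleDl v : {morph quot_scale^~ v : a b / a + b}.
Proof.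
by move=> a b; rewrite -[v]quot_pi_repr -!quot_piZ -quot_piD scalerDl.
Qed.

HB.instance Definition _ := GRing.Zmodule_isLmodule.Build K Q
  quot_scaleA quot_scale1 quot_scaleDr quot_scaleDl.

Lemma quot_pi_linear : linear quot_pi.
Proof. by move=> c x y; rewrite quot_piD quot_piZ. Qed.

Lemma quot_lie_linearl (z : Q) : linear (quot_lie^~ z).
Proof.
move=> c p q; rewrite -[p]quot_pi_repr -[q]quot_pi_repr -[z]quot_pi_repr.
by rewrite -quot_pi_linear -!quot_pi_lie lie_linearl quot_pi_linear.
Qed.
Lemma quot_lie_linearr (z : Q) : linear (quot_lie z).
Proof.
move=> c p q; rewrite -[p]quot_pi_repr -[q]quot_pi_repr -[z]quot_pi_repr.
by rewrite -quot_pi_linear -!quot_pi_lie lie_linearr quot_pi_linear.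
Qed.
Lemma quot_pi0 : quot_pi 0 = 0.
Proof. by rewrite -(subrr 0) quot_piB subrr. Qed.
Lemma quot_lie_alt x : quot_lie x x = 0.
Proof. by rewrite -[x]quot_pi_repr -quot_pi_lie lie_alt quot_pi0. Qed.
Lemma quot_lie_jacobi x y z :
  quot_lie x (quot_lie y z) + quot_lie y (quot_lie z x)
  + quot_lie z (quot_lie x y) = 0.
Proof.
rewrite -[x]quot_pi_repr -[y]quot_pi_repr -[z]quot_pi_repr.
by rewrite -!(quot_pi_lie, quot_piD) lie_jacobi quot_pi0.
Qed.

HB.instance Definition _ := Lmodule_isLieAlgebra.Build K Q
  quot_lie_linearl quot_lie_linearr quot_lie_alt quot_lie_jacobi.

Definition lie_quot : lieAlgType K := Q.
Definition lie_pi (x : L) : lie_quot := quot_pi x.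

Lemma lie_pi_hom : lie_hom lie_pi.
Proof. by split; [exact: quot_pi_linear | exact: quot_pi_lie]. Qed.

End Quotient.

Section FreeLie.
Variables (K : fieldType) (X : Type).

Inductive lie_term : Type :=
  | TGen of X
  | TZero
  | TAdd of lie_term & lie_term
  | TOpp of lie_term
  | TScale of K & lie_term
  | TLie of lie_term & lie_term.

(* The least congruence on terms containing the Lie algebra axioms. *)
Inductive lie_eq : lie_term -> lie_term -> Prop :=
  | lie_eq_refl t : lie_eq t t
  | lie_eq_sym t u : lie_eq t u -> lie_eq u t
  | lie_eq_trans t u v : lie_eq t u -> lie_eq u v -> lie_eq t v
  | lie_eq_add t t' u u' : lie_eq t t' -> lie_eq u u' -> lie_eq (TAdd t u) (TAdd t' u')
  | lie_eq_opp t t' : lie_eq t t' -> lie_eq (TOpp t) (TOpp t')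
  | lie_eq_scale c t t' : lie_eq t t' -> lie_eq (TScale c t) (TScale c t')
  | lie_eq_lie t t' u u' : lie_eq t t' -> lie_eq u u' -> lie_eq (TLie t u) (TLie t' u')
  | lie_eq_addA t u v : lie_eq (TAdd t (TAdd u v)) (TAdd (TAdd t u) v)
  | lie_eq_addC t u : lie_eq (TAdd t u) (TAdd u t)
  | lie_eq_add0 t : lie_eq (TAdd TZero t) t
  | lie_eq_addN t : lie_eq (TAdd (TOpp t) t) TZero
  | lie_eq_scaleA c d t : lie_eq (TScale c (TScale d t)) (TScale (c * d) t)
  | lie_eq_scale1 t : lie_eq (TScale 1 t) t
  | lie_eq_scaleDr c t u : lie_eq (TScale c (TAdd t u)) (TAdd (TScale c t) (TScale c u))
  | lie_eq_scaleDl c d t : lie_eq (TScale (c + d) t) (TAdd (TScale c t) (TScale d t))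
  | lie_eq_lie_linearl c t u v :
      lie_eq (TLie (TAdd (TScale c t) u) v) (TAdd (TScale c (TLie t v)) (TLie u v))
  | lie_eq_lie_linearr c t u v :
      lie_eq (TLie v (TAdd (TScale c t) u)) (TAdd (TScale c (TLie v t)) (TLie v u))
  | lie_eq_lie_alt t : lie_eq (TLie t t) TZero
  | lie_eq_lie_jacobi t u v :
      lie_eq (TAdd (TAdd (TLie t (TLie u v)) (TLie u (TLie v t))) (TLie v (TLie t u)))
        TZero.

HB.instance Definition _ := gen_eqMixin lie_term.
HB.instance Definition _ := gen_choiceMixin lie_term.

Definition lie_eqb (t u : lie_term) : bool := `[< lie_eq t u >].

Lemma lie_eqb_equiv : equiv_class_of lie_eqb.
Proof.
split=> [t|t u|u t v].
- exact/asboolP/lie_eq_refl.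
- by apply/asboolP/asboolP; exact: lie_eq_sym.
- by move=> /asboolP h1 /asboolP h2; apply/asboolP; exact: lie_eq_trans h1 h2.
Qed.

Canonical lie_eqb_equivRel := EquivRelPack lie_eqb_equiv.

Definition free_lie_type := {eq_quot lie_eqb}.
HB.instance Definition _ : EqQuotient lie_term lie_eqb free_lie_type :=
  EqQuotient.on free_lie_type.
HB.instance Definition _ := Choice.on free_lie_type.

Local Notation F := free_lie_type.

Definition free_pi (t : lie_term) : F := \pi_F t.

Lemma free_piP t u : free_pi t = free_pi u <-> lie_eq t u.
Proof. by split=> [/eqmodP/asboolP | h]; last apply/eqmodP/asboolP. Qed.

Lemma free_pi_ind (P : F -> Prop) : (forall t, P (free_pi t)) -> forall x, P x.
Proof. by move=> h x; rewrite -[x]reprK; exact: h. Qed.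

Lemma free_repr_pi t : lie_eq (repr (free_pi t)) t.
Proof. by apply/free_piP; exact: reprK. Qed.

Definition free_zero : F := free_pi TZero.
Definition free_add (x y : F) : F := free_pi (TAdd (repr x) (repr y)).
Definition free_opp (x : F) : F := free_pi (TOpp (repr x)).
Definition free_scale (c : K) (x : F) : F := free_pi (TScale c (repr x)).
Definition free_br (x y : F) : F := free_pi (TLie (repr x) (repr y)).

Lemma free_addE t u : free_add (free_pi t) (free_pi u) = free_pi (TAdd t u).
Proof. by apply/free_piP/lie_eq_add; exact: free_repr_pi. Qed.
Lemma free_oppE t : free_opp (free_pi t) = free_pi (TOpp t).
Proof. by apply/free_piP/lie_eq_opp; exact: free_repr_pi. Qed.
Lemma free_scaleE c t : free_scale c (free_pi t) = free_pi (TScale c t).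
Proof. by apply/free_piP/lie_eq_scale; exact: free_repr_pi. Qed.
Lemma free_brE t u : free_br (free_pi t) (free_pi u) = free_pi (TLie t u).
Proof. by apply/free_piP/lie_eq_lie; exact: free_repr_pi. Qed.
Definition freeE := (free_addE, free_oppE, free_scaleE, free_brE).

Lemma free_addA : associative free_add.
Proof.
elim/free_pi_ind=> t; elim/free_pi_ind=> u; elim/free_pi_ind=> v.
by rewrite !freeE; apply/free_piP; exact: lie_eq_addA.
Qed.
Lemma free_addC : commutative free_add.
Proof.
elim/free_pi_ind=> t; elim/free_pi_ind=> u.
by rewrite !freeE; apply/free_piP; exact: lie_eq_addC.
Qed.
Lemma free_add0 : left_id free_zero free_add.
Proof.
by elim/free_pi_ind=> t; rewrite !freeE; apply/free_piP; exact: lie_eq_add0.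
Qed.
Lemma free_addN : left_inverse free_zero free_opp free_add.
Proof.
by elim/free_pi_ind=> t; rewrite !freeE; apply/free_piP; exact: lie_eq_addN.
Qed.
HB.instance Definition _ := GRing.isZmodule.Build F
  free_addA free_addC free_add0 free_addN.

Lemma free_scaleA c d x : free_scale c (free_scale d x) = free_scale (c * d) x.
Proof.
by elim/free_pi_ind: x => t; rewrite !freeE; apply/free_piP; exact: lie_eq_scaleA.
Qed.
Lemma free_scale1 : left_id 1 free_scale.
Proof.
by elim/free_pi_ind=> t; rewrite !freeE; apply/free_piP; exact: lie_eq_scale1.
Qed.
Lemma free_scaleDr : right_distributive free_scale free_add.
Proof.
move=> c; elim/free_pi_ind=> t; elim/free_pi_ind=> u.
by rewrite !freeE; apply/free_piP; exact: lie_eq_scaleDr.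
Qed.
Lemma free_scaleDl x c d :
  free_scale (c + d) x = free_add (free_scale c x) (free_scale d x).
Proof.
by elim/free_pi_ind: x => t; rewrite !freeE; apply/free_piP; exact: lie_eq_scaleDl.
Qed.
HB.instance Definition _ := GRing.Zmodule_isLmodule.Build K F
  free_scaleA free_scale1 free_scaleDr free_scaleDl.

Lemma free_br_linearl (z : F) : linear (free_br^~ z).
Proof.
move=> c; elim/free_pi_ind=> t; elim/free_pi_ind=> u; elim/free_pi_ind: z => v.
change (free_br (free_add (free_scale c (free_pi t)) (free_pi u)) (free_pi v) =
  free_add (free_scale c (free_br (free_pi t) (free_pi v)))
    (free_br (free_pi u) (free_pi v))).
by rewrite !freeE; apply/free_piP; exact: lie_eq_lie_linearl.
Qed.
Lemma free_br_linearr (z : F) : linear (free_br z).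
Proof.
move=> c; elim/free_pi_ind=> t; elim/free_pi_ind=> u; elim/free_pi_ind: z => v.
change (free_br (free_pi v) (free_add (free_scale c (free_pi t)) (free_pi u)) =
  free_add (free_scale c (free_br (free_pi v) (free_pi t)))
    (free_br (free_pi v) (free_pi u))).
by rewrite !freeE; apply/free_piP; exact: lie_eq_lie_linearr.
Qed.
Lemma free_br_alt x : free_br x x = 0.
Proof.
by elim/free_pi_ind: x => t; rewrite !freeE; apply/free_piP; exact: lie_eq_lie_alt.
Qed.
Lemma free_br_jacobi x y z :
  free_br x (free_br y z) + free_br y (free_br z x) + free_br z (free_br x y) = 0.
Proof.
elim/free_pi_ind: x => t; elim/free_pi_ind: y => u; elim/free_pi_ind: z => v.
change (free_add (free_add
    (free_br (free_pi t) (free_br (free_pi u) (free_pi v)))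
    (free_br (free_pi u) (free_br (free_pi v) (free_pi t))))
    (free_br (free_pi v) (free_br (free_pi t) (free_pi u))) = free_zero).
by rewrite !freeE; apply/free_piP; exact: lie_eq_lie_jacobi.
Qed.
HB.instance Definition _ := Lmodule_isLieAlgebra.Build K F
  free_br_linearl free_br_linearr free_br_alt free_br_jacobi.

Definition free_lie : lieAlgType K := F.
Definition free_gen (x : X) : free_lie := free_pi (TGen x).

End FreeLie.

Arguments free_gen {K X} x.

Section FreeProduct.
Variables (K : fieldType) (L1 L2 : lieAlgType K).

Local Notation F := (free_lie K (L1 + L2)).
Local Notation in1 x := (free_gen (inl x) : F).
Local Notation in2 x := (free_gen (inr x) : F).

(* The relations that make both inclusions Lie algebra morphisms. *)
Inductive free_product_rel : F -> F -> Prop :=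
  | inl_linear c x y : free_product_rel (in1 (c *: x + y)) (c *: in1 x + in1 y)
  | inl_lie x y : free_product_rel (in1 (lie x y)) (lie (in1 x) (in1 y))
  | inr_linear c x y : free_product_rel (in2 (c *: x + y)) (c *: in2 x + in2 y)
  | inr_lie x y : free_product_rel (in2 (lie x y)) (lie (in2 x) (in2 y)).

Definition free_product : lieAlgType K := lie_quot free_product_rel.
Definition free_product_inl (x : L1) : free_product := lie_pi free_product_rel (in1 x).
Definition free_product_inr (x : L2) : free_product := lie_pi free_product_rel (in2 x).

End FreeProduct.

Section WeakCommutativity.
Variables (K : fieldType) (g : lieAlgType K).

(* The copy g^psi is the second factor, with x^psi = free_product_inr x. *)
Inductive weak_comm_rel : free_product g g -> free_product g g -> Prop :=
  | weak_comm x :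
      weak_comm_rel (lie (free_product_inl g x) (free_product_inr g x)) 0.

Definition chi : lieAlgType K := lie_quot weak_comm_rel.

End WeakCommutativity.

(* A Lie algebra morphism g -> Der(L), uncurried. *)
Record lieAction (K : fieldType) (g L : lieAlgType K) := LieAction {
  act :> g -> L -> L;
  act_linearl : forall l, linear (act^~ l);
  act_linearr : forall x, linear (act x);
  act_derivation : forall x l1 l2,
    act x (lie l1 l2) = lie (act x l1) l2 + lie l1 (act x l2);
  act_lie : forall x y l, act (lie x y) l = act x (act y l) - act y (act x l)
}.

Section Semidirect.
Variables (K : fieldType) (g L : lieAlgType K) (d : lieAction g L).

Lemma actD x l1 l2 : d x (l1 + l2) = d x l1 + d x l2.
Proof. by rewrite -[l1]scale1r act_linearr !scale1r. Qed.
Lemma actB x l1 l2 : d x (l1 - l2) = d x l1 - d x l2.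
Proof. by rewrite addrC -scaleN1r act_linearr scaleN1r addrC. Qed.

Definition semidirect_type of lieAction g L := (L * g)%type.
Local Notation S := (semidirect_type d).
HB.instance Definition _ := GRing.Lmodule.on S.

Definition semidirect_lie (p q : S) : S :=
  (lie p.1 q.1 + d p.2 q.1 - d q.2 p.1, lie p.2 q.2).

Lemma semidirect_alt x : semidirect_lie x x = 0.
Proof. by case: x => l x; rewrite /semidirect_lie /= !lie_alt add0r subrr. Qed.

Lemma semidirect_linearl z : linear (semidirect_lie^~ z).
Proof.
move=> c [l x] [l' x']; case: z => k y; congr pair; rewrite /=; last exact: lie_linearl.
rewrite lie_linearl act_linearl act_linearr opprD scalerBr scalerDr.
by rewrite [X in X + _ = _]addrACA [LHS]addrACA.
Qed.

Lemma semidirect_lieNC p q : semidirect_lie p q = - semidirect_lie q p.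
Proof.
case: p q => l x [k y]; congr pair; rewrite /=; last exact: lieNC.
by rewrite opprB opprD -lieNC addrA [d x k + _]addrC.
Qed.

Lemma semidirect_linearr z : linear (semidirect_lie z).
Proof.
move=> c x y; rewrite !(semidirect_lieNC z) semidirect_linearl.
by rewrite opprD scalerN.
Qed.

Lemma semidirect_jacobi p q r :
  semidirect_lie p (semidirect_lie q r) + semidirect_lie q (semidirect_lie r p)
  + semidirect_lie r (semidirect_lie p q) = 0.
Proof.
case: p q r => [l x] [k y] [j z]; congr pair; rewrite /=; last exact: lie_jacobi.
rewrite !lieBr !lieDr !actB !actD !act_derivation !act_lie.
rewrite (lieNC (d x k)) (lieNC (d y j)) (lieNC (d z l)).
rewrite -[RHS](lie_jacobi l k j) !opprB.
rewrite -[LHS]addr0 -!addrA; congr (_ + _).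
have cancelp (t u : L) : t + (- t + u) = u by rewrite addrA subrr add0r.
have canceln (t u : L) : - t + (t + u) = u by rewrite addrA addNr add0r.
rewrite !(addrCA _ (- lie l (d y j))) canceln.
rewrite !(addrCA _ (lie l (d z k))) cancelp.
rewrite !(addrCA _ (lie j (d x k))) cancelp.
rewrite !(addrCA _ (- lie k (d x j))) canceln.
rewrite !(addrCA _ (- d x (d y j))) canceln.
rewrite !(addrCA _ (d x (d z k))) cancelp.
rewrite !(addrCA _ (- d z (d y l))) canceln.
rewrite !(addrCA _ (d y (d z l))) cancelp.
congr (_ + _).
rewrite !(addrCA _ (- lie k (d z l))) canceln.
rewrite !(addrCA _ (- lie j (d y l))) canceln.
rewrite !(addrCA _ (d y (d x j))) cancelp.
rewrite !(addrCA _ (d z (d x k))) cancelp.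
by rewrite addr0.
Qed.

HB.instance Definition _ := Lmodule_isLieAlgebra.Build K S
  semidirect_linearl semidirect_linearr semidirect_alt semidirect_jacobi.

Definition semidirect : lieAlgType K := S.

End Semidirect.

Section PresentedL.
Variables (K : fieldType) (m : nat).

(* inl i stands for a_i, and inr of a pair (i, j) with i < j for b_{i,j}. *)
Definition calL_gens : Type := ('I_m + {ij : 'I_m * 'I_m | (ij.1 < ij.2)%N})%type.

Local Notation F := (free_lie K calL_gens).

Definition fa (i : 'I_m) : F := free_gen (inl i).

Definition fb (i j : 'I_m) : F :=
  if insub (i, j) is Some ij then free_gen (inr ij)
  else if insub (j, i) is Some ji then - free_gen (inr ji)
  else 0.

Inductive calL_letter : F -> Prop :=
  | letter_a t : calL_letter (fa t)
  | letter_b s t : calL_letter (fb s t).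

Definition calL_word (s : seq F) : Prop := {in s, forall u, calL_letter u}.

(* The special positions split the words as s1, p, s2, q, s3 in R2 and as
   s1, p, s2 followed by two last letters in R3; the parity condition says
   that the length n of the left-hand word is odd. *)
Inductive calL_rel : F -> F -> Prop :=
  | calL_R1 i j k l :
      calL_rel (rlie [:: fa i; fa j; fb k l])
               (rlie [:: fa i; fb j k; fa l] + rlie [:: fa i; fa k; fb j l])
  | calL_R2 s1 s2 s3 j j' k k' :
      calL_word s1 -> calL_word s2 -> calL_word s3 ->
      odd (size s1 + 1 + size s2 + 1 + size s3) ->
      calL_rel
        (rlie (s1 ++ fb j j' :: s2 ++ fb k k' :: s3))
        (rlie (s1 ++ lie (fa j) (fa j') :: s2 ++ lie (fa k) (fa k') :: s3))
  | calL_R3 s1 s2 j j' k l :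
      calL_word s1 -> calL_word s2 ->
      odd (size s1 + 1 + size s2 + 2) ->
      calL_rel
        (rlie (s1 ++ fb j j' :: s2 ++ [:: fa k; fa l]))
        (rlie (s1 ++ lie (fa j) (fa j') :: s2 ++ [:: fb k l])).

Definition calL : lieAlgType K := lie_quot calL_rel.
Definition gen_a (i : 'I_m) : calL := lie_pi calL_rel (fa i).
Definition gen_b (i j : 'I_m) : calL := lie_pi calL_rel (fb i j).

End PresentedL.

Arguments gen_a {K m} i.
Arguments gen_b {K m} i j.

(* The action of the free Lie algebra on x_1, ..., x_m by the derivations
   prescribed on the generators of calL. *)
Definition prescribed_action (K : fieldType) (m : nat)
    (d : lieAction (free_lie K 'I_m) (calL K m)) : Prop :=
  (forall s i,
     d (free_gen s) (gen_a i) = 2%:R^-1 *: (lie (gen_a s) (gen_a i) + gen_b s i)) /\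
  (forall s i j,
     d (free_gen s) (gen_b i j) =
       2%:R^-1 *: (lie (gen_a s) (gen_b i j) + rlie [:: gen_a s; gen_a i; gen_a j])).

(* Main.v *)
Require Import Defs.
From HB Require Import structures.
From mathcomp Require Import all_boot all_algebra boolp.
From mathcomp Require Import zify.

(** Write x' for the copy of x in chi(g), and put A(x) = x - x'. Polarizing
    [x, x'] = 0 gives [x, y'] = [x', y], whence [x + x', A(y)] = A([x, y]) and
    A([x, [y, z]]) = [A(x), [A(y), A(z)]]: A is a morphism of Lie triple systems.
    The kernel of chi(g) -> g, x, x' |-> x, is generated by the A(x) subject to
    this identity, and x acts on it by 2 [x, A(y)] = [A(x), A(y)] + A([x, y]).
    For g free, a_i = A(x_i) and b_{i,j} = A([x_i, x_j]) generate the kernel, and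
    the relations R1, R2, R3 have to be seen to say the same as the triple
    identity.

    Words of odd weight. Give a_i and b_{i,j} weight 1 and an entry [a_i, a_j]
    weight 2. Every relation compares right-normed brackets of odd weight, and
    its two sides have the same expansion in the free associative algebra if
    b_{i,j} and [a_i, a_j] are read as x_i x_j - x_j x_i, or as x_i x_j when they
    come last. So in an algebra where odd words depend on their expansions only,
    the relations hold ([calL_ext]). Conversely, the relations suffice to bring
    every odd word of the presented algebra into the normal form that its
    expansion prescribes: [a, ..., a] or [a, ..., a, b] ([crl_ev]).

    This description turns the verification of relations into computations with
    expansions. The derivation D_s with a_i |-> b_{s,i} and
    b_{i,j} |-> [a_s, a_i, a_j] multiplies expansions by x_s from the left, hence
    exists ([shift_exists]), and so does the action by
    (ad a_s + D_s) / 2. The triple identity shows that a_i |-> A(x_i),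
    b_{i,j} |-> A([x_i, x_j]) defines a morphism theta from the presented algebra
    to chi(g) ([calL_to_chi]), compatible with the actions of g.

    For the other direction, send x to x and x_i' to x_i - a_i in the semidirect
    product; as g is free, this defines psi(x) = x - alpha(x) for all x, and
    [x, psi(x)] = 0 means x . alpha(x) = 0. It suffices that
    sigma_x = 2 x - ad alpha(x) satisfies sigma_x (alpha y) = alpha([x, y])
    ([sigma_alpha]). For right-normed brackets this follows by induction on their
    length ([sigma_word]): alpha takes them to normal forms, sigma of x_s is D_s,
    and sigma of [x_t, z] is the inner derivation ad [a_t, alpha(z)]. *)

Set Implicit Arguments.
Unset Strict Implicit.
Unset Printing Implicit Defensive.

Import GRing.Theory.
Local Open Scope ring_scope.

(** * Identities in an additive group *)

Inductive zexpr : Type :=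
  | ZVar of nat
  | ZNull
  | ZPlus of zexpr & zexpr
  | ZMinus of zexpr.

Fixpoint zeval (V : zmodType) (env : seq V) (e : zexpr) : V :=
  match e with
  | ZVar n => env`_n
  | ZNull => 0
  | ZPlus e1 e2 => zeval env e1 + zeval env e2
  | ZMinus e1 => - zeval env e1
  end.

Fixpoint zcoef (e : zexpr) (i : nat) : int :=
  match e with
  | ZVar n => (n == i)%:Z
  | ZNull => 0
  | ZPlus e1 e2 => zcoef e1 i + zcoef e2 i
  | ZMinus e1 => - zcoef e1 i
  end.

Fixpoint zbound (n : nat) (e : zexpr) : bool :=
  match e with
  | ZVar k => (k < n)%N
  | ZNull => true
  | ZPlus e1 e2 => zbound n e1 && zbound n e2
  | ZMinus e1 => zbound n e1
  end.

Lemma zevalE (V : zmodType) (env : seq V) (e : zexpr) :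
  zbound (size env) e ->
  zeval env e = \sum_(i < size env) env`_i *~ zcoef e i.
Proof.
elim: e => [n|_|e1 IH1 e2 IH2|e IH] /=.
- move=> ltn; rewrite (bigD1 (Ordinal ltn)) //= eqxx mulr1z big1 ?addr0 //.
  move=> i /eqP ne; case: eqP => [eqn|]; last by rewrite mulr0z.
  by case: ne; apply: val_inj.
- by rewrite big1 // => i _; rewrite mulr0z.
- case/andP=> b1 b2; rewrite IH1 // IH2 // -big_split /=.
  by apply: eq_bigr => i _; rewrite mulrzDr.
- by move=> b; rewrite IH // -sumrN; apply: eq_bigr => i _; rewrite mulrNz.
Qed.

Lemma zeval_eq (V : zmodType) (env : seq V) (e1 e2 : zexpr) :
  [&& zbound (size env) e1, zbound (size env) e2
    & all (fun i => zcoef e1 i == zcoef e2 i) (iota 0 (size env))] ->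
  zeval env e1 = zeval env e2.
Proof.
case/and3P=> b1 b2 /allP eqc; rewrite !zevalE //.
apply: eq_bigr => i _; congr (_ *~ _); apply/eqP/eqc.
by rewrite mem_iota add0n ltn_ord.
Qed.

(* Atoms are compared up to conversion, since the same sum may carry different
   but convertible instances of its algebraic structure. *)
Ltac zindex t env :=
  lazymatch env with
  | cons ?u ?env' =>
      let same := match goal with
                  | _ => let _ := match goal with _ => unify t u end in constr:(true)
                  | _ => constr:(false)
                  end in
      lazymatch same with
      | true => constr:(0%N)
      | false => let n := zindex t env' in constr:(n.+1)
      end
  end.
Ltac zatoms t env :=
  lazymatch t with
  | GRing.add ?a ?b => let env1 := zatoms a env in zatoms b env1
  | GRing.opp ?a => zatoms a env
  | GRing.zero => env
  | _ => match goal with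
         | _ => let n := zindex t env in env
         | _ => constr:(cons t env)
         end
  end.
Ltac zreify t env :=
  lazymatch t with
  | GRing.add ?a ?b =>
      let ea := zreify a env in let eb := zreify b env in constr:(ZPlus ea eb)
  | GRing.opp ?a => let ea := zreify a env in constr:(ZMinus ea)
  | GRing.zero => constr:(ZNull)
  | _ => let n := zindex t env in constr:(ZVar n)
  end.

(** Decides the equalities that hold in every additive group, the subterms
    other than sums, opposites and zero being atoms. *)
Ltac abel :=
  lazymatch goal with
  | |- @eq ?V ?t ?u =>
      let env0 := zatoms t (@nil V) in
      let env := zatoms u env0 in
      let et := zreify t env in
      let eu := zreify u env in
      exact: (@zeval_eq _ env et eu (erefl true))
  end.

(** * Lie algebras, linear maps and right-normed brackets *)

Section LinearMaps.
Variables (K : fieldType) (V W : lmodType K) (f : V -> W).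
Hypothesis lin_f : linear f.

Lemma linear_D x y : f (x + y) = f x + f y.
Proof. by rewrite -[x]scale1r lin_f !scale1r. Qed.
Lemma linear_0 : f 0 = 0.
Proof. by apply: (addIr (f 0)); rewrite -linear_D !add0r. Qed.
Lemma linear_Z c x : f (c *: x) = c *: f x.
Proof. by rewrite -[c *: x]addr0 lin_f linear_0 addr0. Qed.
Lemma linear_N x : f (- x) = - f x.
Proof. by rewrite -scaleN1r linear_Z scaleN1r. Qed.
Lemma linear_B x y : f (x - y) = f x - f y.
Proof. by rewrite linear_D linear_N. Qed.

End LinearMaps.

Section LieAlgebra.
Variables (K : fieldType) (L : lieAlgType K).
Implicit Types (x y z : L) (s t : seq L).

Lemma lieZl c x z : lie (c *: x) z = c *: lie x z.
Proof. exact: (linear_Z (lie_linearl z)). Qed.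
Lemma lieZr c x z : lie z (c *: x) = c *: lie z x.
Proof. exact: (linear_Z (lie_linearr z)). Qed.
Lemma lieNl x z : lie (- x) z = - lie x z.
Proof. exact: (linear_N (lie_linearl z)). Qed.
Lemma lieNr x z : lie z (- x) = - lie z x.
Proof. exact: (linear_N (lie_linearr z)). Qed.
Lemma lie0l z : lie 0 z = 0.
Proof. exact: (linear_0 (lie_linearl z)). Qed.
Lemma lie0r z : lie z 0 = 0.
Proof. exact: (linear_0 (lie_linearr z)). Qed.

Lemma lie_ad x y z : lie (lie x y) z = lie x (lie y z) - lie y (lie x z).
Proof.
have := lie_jacobi x y z; rewrite (lieNC z x) lieNr (lieNC z) => /eqP.
by rewrite subr_eq0 => /eqP.
Qed.

Lemma rlie_cons x s : s != [::] -> rlie (x :: s) = lie x (rlie s).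
Proof. by case: s. Qed.

Lemma rlie_cat s t : t != [::] -> rlie (s ++ t) = foldr lie (rlie t) s.
Proof.
by move=> t0; elim: s => // x s IH; rewrite cat_cons rlie_cons ?IH //; case: (s).
Qed.

Lemma foldr_lieB s x y : foldr lie (x - y) s = foldr lie x s - foldr lie y s.
Proof. by elim: s => //= z s ->; rewrite lieBr. Qed.
Lemma foldr_lieD s x y : foldr lie (x + y) s = foldr lie x s + foldr lie y s.
Proof. by elim: s => //= z s ->; rewrite lieDr. Qed.

Lemma rlie_comm s x y t : t != [::] ->
  rlie (s ++ lie x y :: t) = rlie (s ++ x :: y :: t) - rlie (s ++ y :: x :: t).
Proof. by move=> t0; rewrite !rlie_cat // -foldr_lieB !rlie_cons // lie_ad. Qed.

Lemma rlie_comm_last s x y : rlie (s ++ [:: lie x y]) = rlie (s ++ [:: x; y]).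
Proof. by rewrite !rlie_cat. Qed.

(** A property that is stable in this sense holds everywhere once it holds on
    generators, which is how morphisms and derivations are compared below. *)
Definition lie_stable (P : L -> Prop) : Prop :=
  [/\ P 0, forall x y, P x -> P y -> P (x + y), forall c x, P x -> P (c *: x)
    & forall x y, P x -> P y -> P (lie x y)].

Lemma hom_eq_stable (M : lieAlgType K) (f g : L -> M) :
  lie_hom f -> lie_hom g -> lie_stable (fun x => f x = g x).
Proof.
case=> lf mf [lg mg]; split=> [|x y|c x|x y].
- by rewrite !linear_0.
- by rewrite (linear_D lf) (linear_D lg) => -> ->.
- by rewrite (linear_Z lf) (linear_Z lg) => ->.
- by rewrite mf mg => -> ->.
Qed.

Definition derivation (D : L -> L) : Prop :=
  linear D /\ forall x y, D (lie x y) = lie (D x) y + lie x (D y).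

Lemma derivation_eq_stable (D E : L -> L) :
  derivation D -> derivation E -> lie_stable (fun x => D x = E x).
Proof.
case=> lD mD [lE mE]; split=> [|x y|c x|x y].
- by rewrite !linear_0.
- by rewrite (linear_D lD) (linear_D lE) => -> ->.
- by rewrite (linear_Z lD) (linear_Z lE) => ->.
- by rewrite mD mE => -> ->.
Qed.

Lemma derivation_ad x : derivation (lie x).
Proof.
split=> [|y z]; first exact: lie_linearr.
by rewrite lie_ad addrNK.
Qed.

Lemma derivation_comb c d (D E : L -> L) : derivation D -> derivation E ->
  derivation (fun x => c *: D x + d *: E x).
Proof.
case=> lD mD [lE mE]; split=> [e x y|x y].
  rewrite lD lE !scalerDr !scalerA (mulrC c) (mulrC d); abel.
rewrite mD mE !scalerDr lieDl lieDr !lieZl !lieZr; abel.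
Qed.

Lemma derivation_comm (D E : L -> L) : derivation D -> derivation E ->
  derivation (fun x => D (E x) - E (D x)).
Proof.
case=> lD mD [lE mE]; split=> [e x y|x y].
  by rewrite lD lE lD lE scalerBr; abel.
rewrite mD mE (linear_D lD) (linear_D lE) !mD !mE lieBl lieBr; abel.
Qed.

End LieAlgebra.

Lemma hom_rlie (K : fieldType) (L M : lieAlgType K) (f : L -> M) s :
  lie_hom f -> f (rlie s) = rlie (map f s).
Proof.
case=> lf mf; elim: s => [|x [|y s] IH] //=; first exact: linear_0.
by rewrite mf IH.
Qed.

Lemma hom_comp (K : fieldType) (L M N : lieAlgType K) (f : L -> M) (g : M -> N) :
  lie_hom f -> lie_hom g -> lie_hom (g \o f).
Proof.
by case=> lf mf [lg mg]; split=> [c x y|x y] /=; rewrite ?lf ?lg ?mf ?mg.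
Qed.

Lemma id_hom (K : fieldType) (L : lieAlgType K) : lie_hom (@id L).
Proof. by split. Qed.

(** * Morphisms out of free Lie algebras, quotients and free products *)

Section FreeLieExtension.
Variables (K : fieldType) (X : Type).
Local Notation F := (free_lie K X).

Lemma free_pi0 : free_pi (TZero K X) = 0 :> F. Proof. by []. Qed.
Lemma free_piD t u : free_pi (TAdd t u) = free_pi t + free_pi u :> F.
Proof. by symmetry; apply: free_addE. Qed.
Lemma free_piN t : free_pi (TOpp t) = - free_pi t :> F.
Proof. by symmetry; apply: free_oppE. Qed.
Lemma free_piZ c t : free_pi (TScale c t) = c *: (free_pi t : F).
Proof. by symmetry; apply: free_scaleE. Qed.
Lemma free_piL t u : free_pi (TLie t u) = lie (free_pi t : F) (free_pi u).
Proof. by symmetry; apply: free_brE. Qed.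
Definition free_piE := (free_pi0, free_piD, free_piN, free_piZ, free_piL).

Lemma free_lie_ind (P : F -> Prop) :
  lie_stable P -> (forall x, P (free_gen x)) -> forall z, P z.
Proof.
case=> P0 PD PZ PL PX; elim/free_pi_ind; elim=> [x||t Pt u Pu|t Pt|c t Pt|t Pt u Pu].
- exact: PX.
- exact: P0.
- by rewrite free_piE; apply: PD.
- by rewrite free_piE -scaleN1r; apply: PZ.
- by rewrite free_piE; apply: PZ.
- by rewrite free_piE; apply: PL.
Qed.

Section Morphism.
Variables (M : lieAlgType K) (h : X -> M).

Fixpoint term_eval (t : lie_term K X) : M :=
  match t with
  | TGen x => h x
  | TZero => 0
  | TAdd t u => term_eval t + term_eval u
  | TOpp t => - term_eval t
  | TScale c t => c *: term_eval t
  | TLie t u => lie (term_eval t) (term_eval u)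
  end.

Lemma term_eval_eq t u : lie_eq t u -> term_eval t = term_eval u.
Proof.
elim=> //= {t u}; try by move=> *; congruence.
- by move=> t u v; rewrite addrA.
- by move=> t u; rewrite addrC.
- by move=> t; rewrite add0r.
- by move=> t; rewrite addNr.
- by move=> c d t; rewrite scalerA.
- by move=> t; rewrite scale1r.
- by move=> c t u; rewrite scalerDr.
- by move=> c d t; rewrite scalerDl.
- by move=> c t u v; rewrite lie_linearl.
- by move=> c t u v; rewrite lie_linearr.
- by move=> t; rewrite lie_alt.
- by move=> t u v; rewrite lie_jacobi.
Qed.

Definition free_ext (z : F) : M := term_eval (repr z).

Lemma free_ext_pi t : free_ext (free_pi t) = term_eval t.
Proof. exact/term_eval_eq/free_repr_pi. Qed.

Lemma free_ext_gen x : free_ext (free_gen x) = h x.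
Proof. exact: free_ext_pi. Qed.

Lemma free_ext_hom : lie_hom free_ext.
Proof.
split=> [c|]; elim/free_pi_ind=> t; elim/free_pi_ind=> u.
  by rewrite -free_piZ -free_piD !free_ext_pi.
by rewrite -free_piL !free_ext_pi.
Qed.

End Morphism.

(** The action is defined by recursion on terms and not as a morphism to a Lie
    algebra of derivations, so that no such algebra has to be set up. *)
Section Action.
Variables (L : lieAlgType K) (D : X -> L -> L).
Hypothesis der_D : forall x, derivation (D x).

Fixpoint term_act (t : lie_term K X) (l : L) : L :=
  match t with
  | TGen x => D x l
  | TZero => 0
  | TAdd t u => term_act t l + term_act u l
  | TOpp t => - term_act t l
  | TScale c t => c *: term_act t l
  | TLie t u => term_act t (term_act u l) - term_act u (term_act t l)
  end.

Lemma term_act_derivation t : derivation (term_act t).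
Proof.
elim: t => [x||t [lt mt] u [lu mu]|t [lt mt]|c t [lt mt]|t dt u du].
- exact: der_D.
- by split=> [c x y|x y] /=; rewrite ?scaler0 ?lie0l ?lie0r addr0.
- split=> [c x y|x y] /=; first by rewrite lt lu scalerDr; abel.
  by rewrite mt mu lieDl lieDr; abel.
- split=> [c x y|x y] /=; first by rewrite lt scalerN; abel.
  by rewrite mt lieNl lieNr; abel.
- split=> [d x y|x y] /=; first by rewrite lt scalerDr !scalerA mulrC.
  by rewrite mt scalerDr lieZl lieZr.
- exact: derivation_comm.
Qed.

Lemma term_act_eq t u : lie_eq t u -> term_act t =1 term_act u.
Proof.
have lin t0 := (term_act_derivation t0).1.
elim=> {t u} //=.
- by move=> t u _ IH l; rewrite IH.
- by move=> t u v _ IH _ IH' l; rewrite IH.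
- by move=> t t' u u' _ IH _ IH' l; rewrite IH IH'.
- by move=> t t' _ IH l; rewrite IH.
- by move=> c t t' _ IH l; rewrite IH.
- by move=> t t' u u' _ IH _ IH' l; rewrite !IH !IH'.
- by move=> t u v l; rewrite addrA.
- by move=> t u l; rewrite addrC.
- by move=> t l; rewrite add0r.
- by move=> t l; rewrite addNr.
- by move=> c d t l; rewrite scalerA.
- by move=> t l; rewrite scale1r.
- by move=> c t u l; rewrite scalerDr.
- by move=> c d t l; rewrite scalerDl.
- by move=> c t u v l; rewrite lin scalerBr; abel.
- by move=> c t u v l; rewrite lin scalerBr; abel.
- by move=> t l; rewrite subrr.
- by move=> t u v l; rewrite !(linear_B (lin _)); abel.
Qed.

Definition free_act (z : F) : L -> L := term_act (repr z).

Lemma free_act_pi t : free_act (free_pi t) =1 term_act t.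
Proof. exact/term_act_eq/free_repr_pi. Qed.

Lemma free_act_linearl l : linear (free_act^~ l).
Proof.
move=> c; elim/free_pi_ind=> t; elim/free_pi_ind=> u.
by rewrite -free_piZ -free_piD !free_act_pi.
Qed.

Lemma free_act_lie x y l :
  free_act (lie x y) l = free_act x (free_act y l) - free_act y (free_act x l).
Proof.
elim/free_pi_ind: x => t; elim/free_pi_ind: y => u.
by rewrite -free_piL !free_act_pi.
Qed.

Definition free_action : lieAction F L :=
  LieAction free_act_linearl (fun x => (term_act_derivation (repr x)).1)
    (fun x => (term_act_derivation (repr x)).2) free_act_lie.

Lemma free_action_gen x l : free_action (free_gen x) l = D x l.
Proof. exact: free_act_pi. Qed.

End Action.

(** Right-normed brackets of generators span the free Lie algebra: their span
    is stable under brackets with generators, hence under brackets with any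
    element, since [[u, v], z] = [u, [v, z]] - [v, [u, z]]. *)
Lemma free_rlie_ind (P : F -> Prop) :
  P 0 -> (forall x y, P x -> P y -> P (x + y)) -> (forall c x, P x -> P (c *: x)) ->
  (forall w : seq X, P (rlie (map free_gen w))) -> forall z, P z.
Proof.
move=> P0 PD PZ Pw.
pose S z := forall J : F -> Prop, J 0 -> (forall x y, J x -> J y -> J (x + y)) ->
  (forall c x, J x -> J (c *: x)) -> (forall w, J (rlie (map free_gen w))) -> J z.
suff Sz : forall z, S z by move=> z; exact: Sz z P P0 PD PZ Pw.
have S0 : S 0 by [].
have SD x y : S x -> S y -> S (x + y).
  by move=> Sx Sy J J0 JD JZ Jw; exact: JD (Sx J J0 JD JZ Jw) (Sy J J0 JD JZ Jw).
have SZ c x : S x -> S (c *: x).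
  by move=> Sx J J0 JD JZ Jw; exact: JZ (Sx J J0 JD JZ Jw).
have Sgen x : S (free_gen x) by move=> J J0 JD JZ Jw; exact: (Jw [:: x]).
have SL : forall x y, S y -> S (lie x y).
  apply: free_lie_ind => [|x y Sy J J0 JD JZ Jw]; last first.
    apply: (Sy (fun y => J (lie (free_gen x) y))) => [|u v|c u|[|y0 w]].
    - by rewrite lie0r.
    - by rewrite lieDr; apply: JD.
    - by rewrite lieZr; apply: JZ.
    - by rewrite lie0r.
    - exact: (Jw [:: x, y0 & w]).
  split=> [y _|x y Sx Sy z Sz|c x Sx z Sz|x y Sx Sy z Sz].
  - by rewrite lie0l.
  - by rewrite lieDl; exact: SD (Sx _ Sz) (Sy _ Sz).
  - by rewrite lieZl; exact: SZ (Sx _ Sz).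
  - by rewrite lie_ad -scaleN1r; exact: SD (Sx _ (Sy _ Sz)) (SZ _ _ (Sy _ (Sx _ Sz))).
by apply: free_lie_ind => //; split=> // x y _; apply: SL.
Qed.

End FreeLieExtension.

Section QuotientMorphism.
Variables (K : fieldType) (L : lieAlgType K) (R : L -> L -> Prop).

Lemma quot_lie_ind (P : lie_quot R -> Prop) :
  (forall x, P (lie_pi R x)) -> forall q, P q.
Proof. by move=> h q; rewrite -[q]quot_pi_repr; apply: h. Qed.

Lemma lie_pi_rel x y : R x y -> lie_pi R x = lie_pi R y.
Proof. by move=> r; apply/quot_piP/asboolP => I _; apply. Qed.

Lemma lie_stable_pi (P : lie_quot R -> Prop) :
  lie_stable P -> lie_stable (fun x => P (lie_pi R x)).
Proof.
have [lp mp] := lie_pi_hom R.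
case=> P0 PD PZ PL; split=> [|x y Px Py|c x Px|x y Px Py].
- by rewrite (linear_0 lp).
- by rewrite (linear_D lp); apply: PD.
- by rewrite (linear_Z lp); apply: PZ.
- by rewrite mp; apply: PL.
Qed.

Variables (M : lieAlgType K) (f : L -> M).
Hypotheses (hom_f : lie_hom f) (f_R : forall x y, R x y -> f x = f y).

Definition quot_ext (q : lie_quot R) : M := f (repr q).

Lemma quot_ext_pi x : quot_ext (lie_pi R x) = f x.
Proof.
have [lf mf] := hom_f.
have /asboolP/(_ (fun z => f z = 0)) := repr_pi_sub R x.
rewrite (linear_B lf) => h; apply/eqP; rewrite -subr_eq0; apply/eqP/h.
  split=> [|y z|c y|y z]; first exact: linear_0.
  - by rewrite (linear_D lf) => -> ->; rewrite addr0.
  - by rewrite (linear_Z lf) => ->; rewrite scaler0.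
  - by rewrite mf => ->; rewrite lie0r.
by move=> y z /f_R; rewrite (linear_B lf) => ->; rewrite subrr.
Qed.

Lemma quot_ext_hom : lie_hom quot_ext.
Proof.
have [[lf mf] [lp mp]] := (hom_f, lie_pi_hom R).
split=> [c|]; elim/quot_lie_ind=> x; elim/quot_lie_ind=> y.
  by rewrite -lp !quot_ext_pi lf.
by rewrite -mp !quot_ext_pi mf.
Qed.

End QuotientMorphism.

Section WeakCommutativityMorphisms.
Variables (K : fieldType) (g : lieAlgType K).

Definition chi_l (x : g) : chi g := lie_pi (@weak_comm_rel K g) (free_product_inl g x).
Definition chi_r (x : g) : chi g := lie_pi (@weak_comm_rel K g) (free_product_inr g x).

Lemma free_product_inl_hom (L1 L2 : lieAlgType K) :
  lie_hom (@free_product_inl K L1 L2).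
Proof.
have [lp mp] := lie_pi_hom (@free_product_rel K L1 L2).
by split=> [c x y|x y]; rewrite /free_product_inl -?lp -?mp;
  apply: lie_pi_rel; constructor.
Qed.

Lemma free_product_inr_hom (L1 L2 : lieAlgType K) :
  lie_hom (@free_product_inr K L1 L2).
Proof.
have [lp mp] := lie_pi_hom (@free_product_rel K L1 L2).
by split=> [c x y|x y]; rewrite /free_product_inr -?lp -?mp;
  apply: lie_pi_rel; constructor.
Qed.

Lemma chi_l_hom : lie_hom chi_l.
Proof. exact: hom_comp (free_product_inl_hom g g) (lie_pi_hom _). Qed.
Lemma chi_r_hom : lie_hom chi_r.
Proof. exact: hom_comp (free_product_inr_hom g g) (lie_pi_hom _). Qed.

Lemma chi_comm x : lie (chi_l x) (chi_r x) = 0.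
Proof.
have [lp mp] := lie_pi_hom (@weak_comm_rel K g).
by rewrite -mp (lie_pi_rel (weak_comm x)) (linear_0 lp).
Qed.

Lemma chi_ind (P : chi g -> Prop) : lie_stable P ->
  (forall x, P (chi_l x)) -> (forall x, P (chi_r x)) -> forall z, P z.
Proof.
move=> sP Pl Pr; elim/quot_lie_ind; elim/quot_lie_ind.
apply: free_lie_ind => [|[x|x]]; [|exact: Pl|exact: Pr].
exact: lie_stable_pi (lie_stable_pi sP).
Qed.

Lemma chi_ext (M : lieAlgType K) (f h : g -> M) : lie_hom f -> lie_hom h ->
  (forall x, lie (f x) (h x) = 0) ->
  exists F : chi g -> M,
    [/\ lie_hom F, forall x, F (chi_l x) = f x & forall x, F (chi_r x) = h x].
Proof.
move=> [lf mf] [lh mh] comm.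
pose e := free_ext (fun x : g + g => match x with inl x => f x | inr x => h x end).
have [le me] : lie_hom e := free_ext_hom _.
have eR x y : free_product_rel x y -> e x = e y.
  by case=> *; rewrite ?le ?me /e !free_ext_gen ?lf ?mf ?lh ?mh.
pose e1 := quot_ext (R := @free_product_rel K g g) e.
have e1_pi := quot_ext_pi (conj le me) eR.
have [le1 me1] : lie_hom e1 := quot_ext_hom (conj le me) eR.
have e1l x : e1 (free_product_inl g x) = f x by rewrite [LHS]e1_pi [LHS]free_ext_gen.
have e1r x : e1 (free_product_inr g x) = h x by rewrite [LHS]e1_pi [LHS]free_ext_gen.
have e1R x y : weak_comm_rel x y -> e1 x = e1 y.
  by case=> z; rewrite me1 e1l e1r comm (linear_0 le1).
exists (quot_ext (R := @weak_comm_rel K g) e1).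
have e2_pi := quot_ext_pi (conj le1 me1) e1R.
split=> [|x|x]; first exact: quot_ext_hom.
- by rewrite [LHS]e2_pi.
- by rewrite [LHS]e2_pi.
Qed.

End WeakCommutativityMorphisms.

(** * Words in the generators and their expansions *)

Section Letters.
Variable m : nat.

(** [One i] stands for a_i; [Two false i j] stands for b_{i,j} and
    [Two true i j] for the bracket [a_i, a_j], which the relations let one
    trade for b_{i,j}. *)
Inductive letter : Type :=
  | One of 'I_m
  | Two of bool & 'I_m & 'I_m.

HB.instance Definition _ := gen_eqMixin letter.

(** The number of generators in the bracket that a letter stands for: the
    relations preserve its parity, and it is odd in each of them. *)
Definition weight (l : letter) : nat := if l is Two true _ _ then 2 else 1.
Definition wt (u : seq letter) : nat := sumn (map weight u).
Definition is_b (l : letter) : bool := if l is Two false _ _ then true else false.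
Definition is_comm (l : letter) : bool := if l is Two true _ _ then true else false.
Definition plain (u : seq letter) : bool := ~~ has is_comm u.
Definition erase (l : letter) : letter := if l is Two _ i j then Two false i j else l.

Lemma wt_cat u v : wt (u ++ v) = (wt u + wt v)%N.
Proof. by rewrite /wt map_cat sumn_cat. Qed.

Lemma wt_cons l u : wt (l :: u) = (weight l + wt u)%N.
Proof. by []. Qed.

Lemma wt_nil : wt [::] = 0%N.
Proof. by []. Qed.

Definition wtE := (wt_cat, wt_cons, wt_nil).

Lemma wt_plain u : plain u -> wt u = size u.
Proof.
by rewrite /plain; elim: u => [|[i|[] i j] u IH] //= pu; rewrite wt_cons IH.
Qed.

Lemma plain_cat u v : plain (u ++ v) = plain u && plain v.
Proof. by rewrite /plain has_cat negb_or. Qed.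

Lemma plain_cons l u : plain (l :: u) = ~~ is_comm l && plain u.
Proof. by rewrite /plain /= negb_or. Qed.

Lemma plain_One p : plain (map One p).
Proof. by elim: p. Qed.

Lemma comm_split u :
  plain u \/ exists s i j t, u = s ++ Two true i j :: t.
Proof.
elim: u => [|l u [pu|[s [i [j [t ->]]]]]]; first by left.
- case: l => [i|[] i j]; [by left| |by left].
  by right; exists [::], i, j, u.
- by right; exists (l :: s), i, j, t.
Qed.

(** As soon as two b's occur, R2 applies; this leaves few other plain words. *)
Lemma plain_split u : plain u ->
  [\/ exists p, u = map One p,
      exists p i j q, u = map One p ++ Two false i j :: map One q
    | exists s1 i j s2 k l s3,
        u = s1 ++ Two false i j :: s2 ++ Two false k l :: s3].
Proof.
elim: u => [|x u IH]; first by move=> _; constructor 1; exists [::].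
case: x => [i|[] i j] // /IH [[p ->]|[p [k [l [q ->]]]]|].
- by constructor 1; exists (i :: p).
- by constructor 2; exists (i :: p), k, l, q.
- case=> s1 [j [k [s2 [l [n [s3 ->]]]]]].
  by constructor 3; exists (One i :: s1), j, k, s2, l, n, s3.
- by constructor 2; exists [::], i, j, p.
- by constructor 3; exists [::], i, j, (map One p), k, l, (map One q).
- case=> s1 [i1 [j1 [s2 [k [l [s3 ->]]]]]].
  by constructor 3; exists [::], i, j, s1, i1, j1, (s2 ++ Two false k l :: s3).
Qed.

(** Expand a word in the free associative algebra on x_1, ..., x_m, reading a_i
    as x_i, and both b_{i,j} and [a_i, a_j] as x_i x_j - x_j x_i, except that
    in last position they are read as x_i x_j; [ev f] is the value at this
    expansion of the linear extension of [f]. *)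
Fixpoint ev (V : zmodType) (f : seq 'I_m -> V) (u : seq letter) : V :=
  match u with
  | [::] => 0
  | [:: One i] => f [:: i]
  | [:: Two _ i j] => f [:: i; j]
  | One i :: u' => ev (fun w => f (i :: w)) u'
  | Two _ i j :: u' =>
      ev (fun w => f [:: i, j & w]) u' - ev (fun w => f [:: j, i & w]) u'
  end.

Section Ev.
Variable V : zmodType.
Implicit Types (f g : seq 'I_m -> V) (s t u : seq letter).

Lemma ev_One f i u : u != [::] -> ev f (One i :: u) = ev (fun w => f (i :: w)) u.
Proof. by case: u. Qed.

Lemma ev_Two f e i j u : u != [::] -> ev f (Two e i j :: u) =
  ev (fun w => f [:: i, j & w]) u - ev (fun w => f [:: j, i & w]) u.
Proof. by case: u. Qed.

Lemma ev_erase f u : ev f (map erase u) = ev f u.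
Proof.
elim: u f => [|[i|e i j] [|l u] IH] f //.
  by rewrite [map _ _]/= [LHS]ev_One // [RHS]ev_One // -IH.
by rewrite [map _ _]/= [LHS]ev_Two // [RHS]ev_Two // -!IH.
Qed.

Lemma ev_last f s e i j :
  ev f (s ++ [:: Two e i j]) = ev f (s ++ [:: One i; One j]).
Proof.
elim: s f => [|l s IH] f //; rewrite !cat_cons.
have n0 x (t : seq letter) : s ++ x :: t != [::] by case: (s).
by case: l => [k|b k l]; [rewrite !ev_One|rewrite !ev_Two] => //; rewrite !IH.
Qed.

Lemma ev_comm f s e i j t : t != [::] -> ev f (s ++ Two e i j :: t) =
  ev f (s ++ [:: One i, One j & t]) - ev f (s ++ [:: One j, One i & t]).
Proof.
move=> t0; elim: s f => [|l s IH] f; first by rewrite !cat0s ev_Two // !ev_One.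
have n0 (v : seq letter) x : s ++ x :: v != [::] by case: (s).
by case: l => [k|b k l]; rewrite !cat_cons ?ev_One ?ev_Two ?IH //; abel.
Qed.

Lemma ev_cat_One f p t : t != [::] ->
  ev f (map One p ++ t) = ev (fun w => f (p ++ w)) t.
Proof.
move=> t0; elim: p f => [|i p IH] f //.
rewrite map_cons cat_cons ev_One ?IH //; case: (p) => //.
Qed.

Lemma ev_map_One f p : p != [::] -> ev f (map One p) = f p.
Proof.
case/lastP: p => // p i _; rewrite -cats1 map_cat ev_cat_One //.
Qed.

Lemma ev_morph (U : zmodType) (h : V -> U) f u :
  {morph h : x y / x - y} -> h (ev f u) = ev (h \o f) u.
Proof.
move=> hB; have h0 : h 0 = 0 by rewrite -(subrr 0) hB subrr.
elim: u f => [|[i|e i j] [|l u] IH] f //; first by rewrite !ev_One ?IH.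
by rewrite !ev_Two // hB !IH.
Qed.

End Ev.

Lemma eq_ev (V : zmodType) (f g : seq 'I_m -> V) u :
  (forall w, w != [::] -> f w = g w) -> ev f u = ev g u.
Proof.
elim: u f g => [|[i|e i j] [|l u] IH] f g fg //; try exact: fg.
  by rewrite !ev_One //; apply: IH => w _; apply: fg.
by rewrite !ev_Two //; congr (_ - _); apply: IH => w _; apply: fg.
Qed.

Section Values.
Variables (K : fieldType) (M : lieAlgType K).
Variables (A : 'I_m -> M) (B : 'I_m -> 'I_m -> M).

Definition lval (l : letter) : M :=
  match l with
  | One i => A i
  | Two true i j => lie (A i) (A j)
  | Two false i j => B i j
  end.

Definition rl (u : seq letter) : M := rlie (map lval u).

Lemma rl_cons l u : u != [::] -> rl (l :: u) = lie (lval l) (rl u).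
Proof. by case: u. Qed.

Lemma rl_cat s t : t != [::] -> rl (s ++ t) = foldr lie (rl t) (map lval s).
Proof. by move=> t0; rewrite /rl map_cat rlie_cat //; case: (t) t0. Qed.

Lemma rl_comm s i j t : t != [::] -> rl (s ++ Two true i j :: t) =
  rl (s ++ [:: One i, One j & t]) - rl (s ++ [:: One j, One i & t]).
Proof. by move=> t0; rewrite /rl !map_cat /= rlie_comm //; case: (t) t0. Qed.

Lemma rl_last s i j : rl (s ++ [:: Two true i j]) = rl (s ++ [:: One i; One j]).
Proof. by rewrite /rl !map_cat /= rlie_comm_last. Qed.

(** Words and their expansions both turn a letter [Two true i j] into the
    commutator of [One i] and [One j], so a comparison of the two may be made on
    plain words; as the number of b's does not change, this is compatible with
    an induction on it. *)
Lemma rl_ev_plain (f : seq 'I_m -> M) n :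
  (forall u, plain u -> (count is_b u <= n)%N -> odd (wt u) -> rl u = ev f u) ->
  forall u, (count is_b u <= n)%N -> odd (wt u) -> rl u = ev f u.
Proof.
move=> Hp u; move: {2}(count is_comm u) (leqnn (count is_comm u)) => k.
elim: k u => [|k IH] u; first by rewrite leqNgt -has_count; apply: Hp.
case: (comm_split u) => [pu _|[s [i [j [t ->]]]]]; first exact: Hp.
rewrite !count_cat !wt_cat /= => hk hn ho.
case: t => [|l t] in hk hn ho *.
  by rewrite rl_last ev_last; apply: IH; rewrite ?count_cat ?wt_cat /=; lia.
rewrite rl_comm // ev_comm //; congr (_ - _); apply: IH;
  by move: hk hn ho; rewrite ?count_cat ?wt_cat /= !wt_cons /=; lia.
Qed.

End Values.

(** Brackets of odd and even length alike are values of expansions if b_{i,j} is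
    read as [a_i, a_j]. *)
Lemma rl_ev_lie (K : fieldType) (M : lieAlgType K) (A : 'I_m -> M) u :
  rl A (fun i j => lie (A i) (A j)) u = ev (fun w => rlie (map A w)) u.
Proof.
have step i (v : seq letter) : lie (A i) (ev (fun w => rlie (map A w)) v) =
    ev (fun w => rlie (map A (i :: w))) v.
  rewrite (ev_morph (h := lie (A i))); last by move=> x y; rewrite lieBr.
  by apply: eq_ev => -[].
have step2 i j (v : seq letter) :
    lie (A i) (lie (A j) (ev (fun w => rlie (map A w)) v)) =
    ev (fun w => rlie (map A [:: i, j & w])) v.
  rewrite step (ev_morph (h := lie (A i))); last by move=> x y; rewrite lieBr.
  by apply: eq_ev => -[].
elim: u => [|[i|[] i j] [|l u] IH] //; rewrite rl_cons ?IH // [lval _ _ _]/=.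
- by rewrite step.
- by rewrite lie_ad !step2.
- by rewrite lie_ad !step2.
Qed.

End Letters.

Arguments One {m} _.
Arguments weight {m} _.
Arguments is_b {m} _.
Arguments is_comm {m} _.
Arguments erase {m} _.

(** * The presented algebra *)

Section Presentation.
Variables (K : fieldType) (m : nat).
Local Notation F := (free_lie K (calL_gens m)).
Local Notation L := (calL K m).
Local Notation flval := (lval (@fa K m) (@fb K m)).
Local Notation word := (seq (letter m)).
Local Notation crl := (rl (@gen_a K m) (@gen_b K m)).

Lemma calL_hom : lie_hom (lie_pi (@calL_rel K m)).
Proof. exact: lie_pi_hom. Qed.

Lemma fb_alt (i : 'I_m) : fb K i i = 0.
Proof. by rewrite /fb insubF // ltnn. Qed.

Lemma fb_anti (i j : 'I_m) : fb K j i = - fb K i j.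
Proof.
have [lt_ij|lt_ji|/val_inj->] := ltngtP i j; last by rewrite fb_alt oppr0.
  rewrite /fb [insub (j, i)]insubF /=; last by rewrite ltnNge ltnW.
  by case: insubP => //=; rewrite lt_ij.
rewrite /fb [insub (i, j)]insubF /=; last by rewrite ltnNge ltnW.
by case: insubP => //=; rewrite ?lt_ji // => u; rewrite opprK.
Qed.

Lemma gen_b_alt (i : 'I_m) : gen_b i i = 0 :> L.
Proof. by rewrite /gen_b fb_alt (linear_0 calL_hom.1). Qed.

Lemma gen_b_anti (i j : 'I_m) : gen_b j i = - gen_b i j :> L.
Proof. by rewrite /gen_b fb_anti (linear_N calL_hom.1). Qed.

Lemma calL_ind (P : L -> Prop) : lie_stable P ->
  (forall i, P (gen_a i)) -> (forall i j, P (gen_b i j)) -> forall x, P x.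
Proof.
move=> sP Pa Pb; elim/quot_lie_ind.
apply: free_lie_ind; first exact: lie_stable_pi.
case=> [i|[[i j] ij]]; first exact: Pa.
suff -> : free_gen (inr (exist _ (i, j) ij)) = fb K i j by apply: Pb.
by rewrite /fb (insubT (fun p : 'I_m * 'I_m => (p.1 < p.2)%N) ij).
Qed.

Lemma calL_wordP (s : seq F) :
  calL_word s -> exists2 u : word, plain u & s = map flval u.
Proof.
elim: s => [|x s IH] ws; first by exists [::].
have [|u pu ->] := IH; first by move=> y ys; apply: ws; rewrite inE ys orbT.
have [i|i j] := ws _ (mem_head x s); first by exists (One i :: u).
by exists (Two false i j :: u).
Qed.

Lemma plain_calL_word (u : word) : plain u -> calL_word (map flval u).
Proof.
rewrite /plain; elim: u => [|x u IH] //= /norP[px pu] y; rewrite inE.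
case/orP=> [/eqP->|]; last exact: IH.
by case: x px => [i|[] i j] // _; [exact: letter_a|exact: letter_b].
Qed.

Section Criterion.
Variables (M : lieAlgType K) (A : 'I_m -> M) (B : 'I_m -> 'I_m -> M).
Variable f : seq 'I_m -> M.
Hypotheses (B_alt : forall i, B i i = 0) (B_anti : forall i j, B j i = - B i j).
Hypothesis rl_ev : forall u : word, odd (wt u) -> rl A B u = ev f u.

Let e : F -> M := free_ext (fun x =>
  match x with inl i => A i | inr ij => B (sval ij).1 (sval ij).2 end).

Let e_hom : lie_hom e. Proof. exact: free_ext_hom. Qed.

Let e_fb i j : e (fb K i j) = B i j.
Proof.
have e_inr u : e (free_gen (inr u)) = B (val u).1 (val u).2 by apply: free_ext_gen.
rewrite /fb; case: insubP => [u _ def_u|]; first by rewrite e_inr def_u.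
case: insubP => [u _ def_u|] /=.
  by rewrite (linear_N e_hom.1) e_inr def_u B_anti opprK.
case: ltngtP => // /val_inj-> _ _; rewrite B_alt.
exact: (linear_0 e_hom.1).
Qed.

Let e_flval l : e (flval l) = lval A B l.
Proof.
have e_fa i : e (fa K i) = A i by apply: free_ext_gen.
case: l => [i|[] i j] /=; [exact: e_fa| |exact: e_fb].
by rewrite e_hom.2 !e_fa.
Qed.

Let e_rl u : e (rlie (map flval u)) = rl A B u.
Proof. by rewrite (hom_rlie _ e_hom) -map_comp (eq_map e_flval). Qed.

(** The two sides of each defining relation have the same expansion. *)
Lemma calL_rel_ext x y : calL_rel x y -> e x = e y.
Proof.
case=> {x y} [i j k l|s1 s2 s3 j j' k k'|s1 s2 j j' k l].
- rewrite (linear_D e_hom.1).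
  rewrite (e_rl [:: One i; One j; Two false k l]).
  rewrite (e_rl [:: One i; Two false j k; One l]).
  rewrite (e_rl [:: One i; One k; Two false j l]).
  by rewrite !rl_ev //= subrK.
- move=> /calL_wordP[u1 p1 ->] /calL_wordP[u2 p2 ->] /calL_wordP[u3 p3 ->].
  rewrite !size_map -!wt_plain // => ho.
  have := e_rl (u1 ++ Two false j j' :: u2 ++ Two false k k' :: u3).
  have := e_rl (u1 ++ Two true j j' :: u2 ++ Two true k k' :: u3).
  rewrite !map_cat /= !map_cat /= => -> ->.
  rewrite !rl_ev ?wtE /=; try by move: ho; lia.
  by rewrite -ev_erase -[RHS]ev_erase !map_cat /= !map_cat.
- move=> /calL_wordP[u1 p1 ->] /calL_wordP[u2 p2 ->].
  rewrite !size_map -!wt_plain // => ho.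
  have := e_rl (u1 ++ Two false j j' :: u2 ++ [:: One k; One l]).
  have := e_rl (u1 ++ Two true j j' :: u2 ++ [:: Two false k l]).
  rewrite !map_cat /= !map_cat /= => -> ->.
  rewrite !rl_ev ?wtE /=; try by move: ho; lia.
  rewrite -[_ :: u2 ++ [:: One k; _]]cat_cons catA -(ev_last _ _ false) -catA.
  by rewrite -ev_erase -[RHS]ev_erase !map_cat /= !map_cat.
Qed.

Lemma calL_ext : exists h : L -> M,
  [/\ lie_hom h, forall i, h (gen_a i) = A i & forall i j, h (gen_b i j) = B i j].
Proof.
exists (quot_ext (R := @calL_rel K m) e).
have h_pi := quot_ext_pi e_hom calL_rel_ext.
split=> [|i|i j]; first exact: quot_ext_hom e_hom calL_rel_ext.
- by rewrite [LHS]h_pi; apply: free_ext_gen.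
- by rewrite [LHS]h_pi.
Qed.

End Criterion.

Lemma pi_flval l : lie_pi (@calL_rel K m) (flval l) = lval gen_a gen_b l.
Proof. by case: l => [i|[] i j] //=; rewrite calL_hom.2. Qed.

Lemma crl_pi u : crl u = lie_pi (@calL_rel K m) (rlie (map flval u)).
Proof. by rewrite (hom_rlie _ calL_hom) -map_comp (eq_map pi_flval). Qed.

Lemma calL_rel1 i j k l :
  crl [:: One i; One j; Two false k l] =
  crl [:: One i; Two false j k; One l] + crl [:: One i; One k; Two false j l].
Proof.
rewrite !crl_pi -(linear_D calL_hom.1).
by apply: lie_pi_rel; apply: calL_R1.
Qed.

Lemma calL_rel2 u1 u2 u3 j j' k k' : plain u1 -> plain u2 -> plain u3 ->
  odd (size u1 + size u2 + size u3) ->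
  crl (u1 ++ Two false j j' :: u2 ++ Two false k k' :: u3) =
  crl (u1 ++ Two true j j' :: u2 ++ Two true k k' :: u3).
Proof.
move=> p1 p2 p3 ho; rewrite !crl_pi !map_cat /= !map_cat /=.
apply: lie_pi_rel; apply: calL_R2; try exact: plain_calL_word.
by rewrite !size_map; lia.
Qed.

Lemma calL_rel3 u1 u2 j j' k l : plain u1 -> plain u2 ->
  odd (size u1 + size u2 + 1) ->
  crl (u1 ++ Two false j j' :: u2 ++ [:: One k; One l]) =
  crl (u1 ++ Two true j j' :: u2 ++ [:: Two false k l]).
Proof.
move=> p1 p2 ho; rewrite !crl_pi !map_cat /= !map_cat /=.
apply: lie_pi_rel; apply: calL_R3; try exact: plain_calL_word.
by rewrite !size_map; lia.
Qed.

(** The normal forms of odd weight: a word of even length needs one b, which is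
    put last. *)
Fixpoint nform (w : seq 'I_m) : L :=
  match w with
  | [::] => 0
  | [:: i] => gen_a i
  | [:: i; j] => gen_b i j
  | i :: j :: w' => lie (gen_a i) (lie (gen_a j) (nform w'))
  end.

Lemma nform_cons2 i j w : w != [::] ->
  nform [:: i, j & w] = lie (gen_a i) (lie (gen_a j) (nform w)).
Proof. by case: w. Qed.

Lemma rl_nform_a p : odd (size p) -> crl (map One p) = nform p.
Proof.
have [n] := ubnP (size p); elim: n p => // n IH [|i [|j [|k p]]] // hn ho.
by rewrite nform_cons2 // -IH //; move: hn ho => /=; lia.
Qed.

Lemma rl_nform_b p i j :
  ~~ odd (size p) -> crl (map One p ++ [:: Two false i j]) = nform (p ++ [:: i; j]).
Proof.
have [n] := ubnP (size p); elim: n p => // n IH [|k [|l p]] // hn ho.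
rewrite !cat_cons nform_cons2 -?IH; last by case: (p).
- by rewrite !rl_cons //; case: (p).
- by move: hn => /=; lia.
- by move: ho; rewrite /= negbK.
Qed.

Lemma crl_ev_last p i j : ~~ odd (size p) ->
  crl (map One p ++ [:: Two false i j]) = ev nform (map One p ++ [:: Two false i j]).
Proof. by move=> ho; rewrite rl_nform_b // ev_cat_One. Qed.

(** A single b followed by at least two a's is moved to the end by R3; if only
    one a follows, parity puts an a before it, and R1 applies. *)
Lemma crl_ev_one_b p i j q : ~~ odd (size p + size q) ->
  crl (map One p ++ Two false i j :: map One q) =
  ev nform (map One p ++ Two false i j :: map One q).
Proof.
case/lastP: q => [|q l]; first by rewrite addn0; apply: crl_ev_last.
case/lastP: q => [|q k].
  case/lastP: p => [|p k]; first by rewrite /=.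
  rewrite !size_rcons /= => ho.
  have catE x y : map One (rcons p k) ++ [:: x, y & [::]]
    = map One p ++ [:: One k; x; y] by rewrite -cats1 map_cat -catA.
  have oneE x y : map One p ++ [:: One k; One x; y] = map One (p ++ [:: k; x]) ++ [:: y].
    by rewrite map_cat -catA.
  rewrite /= catE rl_cat // (canRL (addrK _) (esym (calL_rel1 _ _ _ _))).
  rewrite foldr_lieB -!rl_cat // !oneE !crl_ev_last ?size_cat /=; try by move: ho; lia.
  by rewrite -!oneE !ev_cat_One.
rewrite !size_rcons => ho.
have -> : map One (rcons (rcons q k) l) = map One q ++ [:: One k; One l] :> word.
  by rewrite -!cats1 !map_cat -catA.
rewrite calL_rel3 ?plain_One ?size_map //; last by move: ho; lia.
have n0 t : map One q ++ [:: t] != [::] :> word by case: (q).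
have oneE x y t : map One p ++ [:: One x, One y & map One q ++ [:: t]] =
    map One (p ++ [:: x, y & q]) ++ [:: t] by rewrite map_cat -catA.
rewrite rl_comm // !oneE !crl_ev_last ?size_cat /=; try by move: ho; lia.
rewrite -!oneE -(ev_comm _ _ false) // -[_ :: _ ++ [:: One k; _]]cat_cons catA.
by rewrite -(ev_last _ _ false) -catA.
Qed.

(** Every odd word is the normal form of its expansion: R2 trades the b's, two at
    a time, for brackets of a's. *)
Theorem crl_ev u : odd (wt u) -> crl u = ev nform u.
Proof.
have step v : plain v -> odd (wt v) ->
    (forall w, (count is_b w < count is_b v)%N -> odd (wt w) -> crl w = ev nform w) ->
    crl v = ev nform v.
  move=> pv; have := plain_split pv; move: pv => /[swap] -[].
  - case=> p -> pv; rewrite wt_plain // size_map => ho _.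
    by rewrite rl_nform_a // ev_map_One //; case: (p) ho.
  - case=> p [i [j [q ->]]] pv; rewrite wt_plain // size_cat /= !size_map => ho _.
    by apply: crl_ev_one_b; move: ho; lia.
  case=> u1 [i [j [u2 [k [l [u3 ->]]]]]].
  rewrite !(plain_cat, plain_cons) /= => /and3P[p1 p2 p3].
  rewrite !wtE /= !wt_plain // => ho IH.
  rewrite calL_rel2 //; last by move: ho; lia.
  rewrite IH ?count_cat /= ?count_cat /= ?wtE /=; last by rewrite !wt_plain //; lia.
    by rewrite -ev_erase -[RHS]ev_erase !map_cat /= !map_cat.
  by lia.
move: {2}_.+1 (ltnSn (count is_b u)) => n; elim: n u => // n IH u hn.
apply: (rl_ev_plain (n := count is_b u)) => // v pv hv ov; apply: step => // w hw.
by apply: IH; lia.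
Qed.

End Presentation.

(** * Derivations as morphisms to dual numbers *)

Section DualNumbers.
Variables (K : fieldType) (L : lieAlgType K).

Definition dual_type of lieAlgType K := (L * L)%type.
Local Notation D := (dual_type L).
HB.instance Definition _ := GRing.Lmodule.on D.

Definition dual_lie (p q : D) : D := (lie p.1 q.1, lie p.2 q.1 + lie p.1 q.2).

Lemma dual_linearl z : linear (dual_lie^~ z).
Proof.
move=> c [x x'] [y y']; congr pair => /=; first exact: lie_linearl.
by rewrite !lie_linearl scalerDr; abel.
Qed.

Lemma dual_alt x : dual_lie x x = 0.
Proof. by congr pair; rewrite /= ?lie_alt // lieNC addNr. Qed.

Lemma dual_lieNC p q : dual_lie p q = - dual_lie q p.
Proof.
congr pair => /=; first exact: lieNC.
by rewrite lieNC (lieNC p.1); abel.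
Qed.

Lemma dual_linearr z : linear (dual_lie z).
Proof.
by move=> c x y; rewrite !(dual_lieNC z) dual_linearl opprD scalerN.
Qed.

Lemma dual_jacobi x y z :
  dual_lie x (dual_lie y z) + dual_lie y (dual_lie z x)
  + dual_lie z (dual_lie x y) = 0.
Proof.
case: x y z => [x x'] [y y'] [z z']; congr pair => /=; first exact: lie_jacobi.
rewrite !lieDr; transitivity ((lie x' (lie y z) + lie y (lie z x') + lie z (lie x' y))
  + (lie x (lie y' z) + lie y' (lie z x) + lie z (lie x y'))
  + (lie x (lie y z') + lie y (lie z' x) + lie z' (lie x y))); first by abel.
by rewrite !lie_jacobi !addr0.
Qed.

HB.instance Definition _ := Lmodule_isLieAlgebra.Build K D
  dual_linearl dual_linearr dual_alt dual_jacobi.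

Definition dual : lieAlgType K := D.

Lemma dual_fst_hom : lie_hom (fst : dual -> L).
Proof. by split. Qed.

Lemma hom_dual_derivation (h : L -> dual) :
  lie_hom h -> (forall x, (h x).1 = x) -> derivation (fun x => (h x).2).
Proof.
case=> lh mh h1; split=> [c x y|x y]; first by rewrite lh.
by rewrite mh /= !h1.
Qed.

End DualNumbers.

(** * The derivations D_s of the presented algebra *)

Section Shift.
Variables (K : fieldType) (m : nat).
Local Notation L := (calL K m).
Local Notation word := (seq (letter m)).
Local Notation crl := (rl (@gen_a K m) (@gen_b K m)).
Local Notation cval := (lval (@gen_a K m) (@gen_b K m)).
Local Notation nform := (@nform K m).

(** A word of odd weight that represents [nform w]. *)
Lemma nform_word (w : seq 'I_m) : w != [::] ->
  exists2 u : word, odd (wt u) & forall (V : zmodType) (f : seq 'I_m -> V), ev f u = f w.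
Proof.
have [ow|ew] := boolP (odd (size w)) => w0.
  exists (map One w) => [|V f]; last exact: ev_map_One.
  by rewrite wt_plain ?size_map ?plain_One.
case/lastP: w => [|w j] // in ew w0 *; case/lastP: w => [|w i] // in ew w0 *.
rewrite !size_rcons /= !negbK in ew.
exists (map One w ++ [:: Two false i j]) => [|V f].
  by rewrite wt_cat wt_plain ?plain_One // size_map /= !wtE /=; lia.
by rewrite ev_cat_One // -!cats1 -catA.
Qed.

Lemma lie_nform_word (l1 l2 : letter m) (w : seq 'I_m) (u : word) :
  odd (wt u) -> (forall f : seq 'I_m -> L, ev f u = f w) ->
  lie (cval l1) (lie (cval l2) (nform w)) = crl [:: l1, l2 & u].
Proof.
move=> ou evu; have u0 : u != [::] by case: (u) ou.
by rewrite !rl_cons // crl_ev // evu.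
Qed.

Lemma ev_swap_comm (f : seq 'I_m -> L) (p : word) e i j t : t != [::] ->
  ev f (p ++ Two e i j :: t) + ev f (p ++ [:: One j, One i & t]) =
  ev f (p ++ [:: One i, One j & t]).
Proof. by move=> t0; rewrite ev_comm // subrK. Qed.

(** In the dual numbers, where a_i and b_{i,j} are deformed as a derivation D_s
    prescribes, the infinitesimal part of an odd word expands to x_s times the
    expansion of that word. The telescoping sum behind this is easier to see
    under a prefix [p]: the summand for a letter after [p] moves x_s past it. *)
Section Deformation.
Variable s : 'I_m.

Definition shift_a (i : 'I_m) : dual L := (gen_a i, gen_b s i).
Definition shift_b (i j : 'I_m) : dual L :=
  (gen_b i j, rlie [:: gen_a s; gen_a i; gen_a j]).
Local Notation drl := (rl shift_a shift_b).

Lemma drl_fst u : (drl u).1 = crl u.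
Proof.
rewrite -[LHS]/(fst (drl u)) (hom_rlie _ (dual_fst_hom L)) -map_comp.
by congr rlie; apply: eq_map => -[i|[] i j].
Qed.

Lemma drl_snd p u : plain u -> u != [::] -> odd (wt p + wt u) ->
  foldr lie (drl u).2 (map cval p) = ev nform (p ++ One s :: u).
Proof.
elim: u p => // l u IH p; rewrite plain_cons => /andP[pl pu] _ ho.
have [u_nil|u0] := eqVneq u [::].
  rewrite u_nil {IH} in ho *; case: l pl ho => [i|[] i j] // _.
    rewrite wtE /= => ho; rewrite -(ev_last _ _ false) -crl_ev ?rl_cat //.
    by rewrite wt_cat.
  rewrite !wtE /= => ho.
  rewrite -[[:: One s; _]]cat1s catA ev_last -crl_ev -?catA ?rl_cat //.
  by rewrite !wtE /=; move: ho; lia.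
have -> : (drl (l :: u)).2 =
    lie (lval shift_a shift_b l).2 (crl u) + lie (cval l) (drl u).2.
  by rewrite rl_cons //= drl_fst; case: l {pl ho} => [i|[] i j].
rewrite foldr_lieD.
have -> : foldr lie (lie (cval l) (drl u).2) (map cval p) =
    ev nform (p ++ [:: l, One s & u]).
  by rewrite -cat_rcons -IH // ?map_rcons ?foldr_rcons //
     -cats1 wt_cat; move: ho; rewrite !wtE; lia.
case: l pl ho => [i|[] i j] // _; rewrite !wtE /= => ho.
  have -> : foldr lie (lie (gen_b s i) (crl u)) (map cval p) =
      ev nform (p ++ Two false s i :: u).
    by rewrite -crl_ev ?rl_cat // ?rl_cons // !wtE /=; move: ho; lia.
  exact: ev_swap_comm.
rewrite lie_ad foldr_lieB.
have -> : foldr lie (lie (gen_a s) (lie (lie (gen_a i) (gen_a j)) (crl u))) (map cval p)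
    = ev nform (p ++ [:: One s, Two true i j & u]).
  by rewrite -crl_ev ?rl_cat // ?rl_cons // !wtE /=; move: ho; lia.
have -> : foldr lie (lie (lie (gen_a i) (gen_a j)) (lie (gen_a s) (crl u))) (map cval p)
    = ev nform (p ++ [:: Two true i j, One s & u]).
  by rewrite -crl_ev ?rl_cat // ?rl_cons // !wtE /=; move: ho; lia.
have eraseE (v v' : word) : map erase v = map erase v' -> ev nform v = ev nform v'.
  by rewrite -(ev_erase _ v) => ->; rewrite ev_erase.
rewrite (eraseE (p ++ [:: One s, Two true i j & u])
                (p ++ [:: One s, Two false i j & u])) ?map_cat //.
by rewrite (eraseE (p ++ [:: Two true i j, One s & u])
                   (p ++ [:: Two false i j, One s & u])) ?map_cat // subrK.
Qed.

Lemma drl_ev u : odd (wt u) ->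
  drl u = ev (fun w => (nform w, nform (s :: w)) : dual L) u.
Proof.
apply: (rl_ev_plain (n := count is_b u)) => // {}u pu _ ou.
have u0 : u != [::] by case: (u) ou.
rewrite [LHS]surjective_pairing [RHS]surjective_pairing drl_fst; congr pair.
  by rewrite crl_ev // (ev_morph (h := fst : dual L -> L)).
rewrite -[LHS]/(foldr lie (drl u).2 (map cval [::])) drl_snd // cat0s ev_One //.
by rewrite (ev_morph (h := snd : dual L -> L)).
Qed.

Lemma shift_b_alt i : shift_b i i = 0.
Proof. by congr pair; rewrite ?gen_b_alt //= lie_alt lie0r. Qed.

Lemma shift_b_anti i j : shift_b j i = - shift_b i j.
Proof. by congr pair; rewrite ?(gen_b_anti _ i j) //= (lieNC (gen_a j)) lieNr. Qed.

End Deformation.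

Lemma shift_exists s : exists D : L -> L,
  [/\ derivation D, forall i, D (gen_a i) = gen_b s i,
      forall i j, D (gen_b i j) = rlie [:: gen_a s; gen_a i; gen_a j]
    & forall w, w != [::] -> D (nform w) = nform (s :: w)].
Proof.
have [h [hh ha hb]] := calL_ext (shift_b_alt s) (shift_b_anti s) (@drl_ev s).
have h1 x : (h x).1 = x.
  move: x; apply: calL_ind; last 2 first.
  - by move=> i; rewrite ha.
  - by move=> i j; rewrite hb.
  exact: hom_eq_stable (hom_comp hh (dual_fst_hom L)) (id_hom L).
exists (fun x => (h x).2); split.
- exact: hom_dual_derivation.
- by move=> i; rewrite ha.
- by move=> i j; rewrite hb.
move=> w /nform_word[u ou evu].
rewrite -(evu _ nform) -crl_ev // (hom_rlie _ hh) -map_comp.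
suff -> : map (h \o cval) u = map (lval (shift_a s) (shift_b s)) u.
  by rewrite [rlie _](drl_ev s ou) evu.
by apply: eq_map => -[i|[] i j] /=; rewrite ?hh.2 ?ha ?hb.
Qed.

(** The element [a_r, b_{t,l}] - [a_t, b_{r,l}] - [b_{r,t}, a_l] is central, by R1
    and, for brackets with a b, by R2; longer words behave in the same way. *)
Lemma nform_central (x : L) r t w : w != [::] ->
  lie x (lie (gen_b r t) (nform w)) + lie x (lie (gen_a t) (nform (r :: w))) =
  lie x (lie (gen_a r) (nform (t :: w))).
Proof.
move=> w0; rewrite -lieDr.
have [u ou evu] := nform_word w0.
have [u1 ou1 evu1] := nform_word (w := r :: w) isT.
have [u2 ou2 evu2] := nform_word (w := t :: w) isT.
have n0 (v : word) : odd (wt v) -> v != [::] by case: v.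
have central l : weight l = 1%N ->
    lie (cval l) (lie (gen_b r t) (nform w) + lie (gen_a t) (nform (r :: w))) =
    lie (cval l) (lie (gen_a r) (nform (t :: w))).
  move=> wl; rewrite lieDr (lie_nform_word l (Two false r t) ou) //.
  rewrite (lie_nform_word l (One t) ou1) // (lie_nform_word l (One r) ou2) //.
  rewrite !crl_ev ?wtE ?wl; try by rewrite /=; lia.
  have nu := (n0 _ ou, n0 _ ou1, n0 _ ou2).
  case: l wl => [i|e i j] _; rewrite !(ev_One, ev_Two) ?nu //;
    by rewrite !evu !evu1 !evu2; abel.
move: x; apply: calL_ind; last 2 first.
- by move=> i; apply: (central (One i)).
- by move=> i j; apply: (central (Two false i j)).
split=> [|x y|c x|x y]; rewrite ?lie0l ?lieDl ?lieZl ?lie_ad //.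
- by move=> -> ->.
- by move=> ->.
- by move=> hx hy; rewrite hx hy.
Qed.

End Shift.

(** * Antisymmetric elements in the weak commutativity construction *)

Lemma dbl_inj (K : fieldType) (V : lmodType K) (x y : V) :
  2%N \notin [pchar K] -> x + x = y + y -> x = y.
Proof.
move=> K2; rewrite -!mulr2n -!(scaler_nat 2).
have n2 : 2%:R != 0 :> K by move: K2; rewrite !inE.
exact: (scalerI n2).
Qed.

Lemma half_dbl (K : fieldType) (V : lmodType K) (x : V) :
  2%N \notin [pchar K] -> 2%:R^-1 *: x + 2%:R^-1 *: x = x.
Proof.
move=> K2; rewrite -mulr2n -(scaler_nat 2) scalerA mulfV ?scale1r //.
Qed.

Section AntisymmetricElements.
Variables (K : fieldType) (g : lieAlgType K).
Local Notation l := (@chi_l K g).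
Local Notation r := (@chi_r K g).
Implicit Types (x y z : g).

Definition anti (x : g) : chi g := l x - r x.

Let lD := linear_D (chi_l_hom g).1.
Let rD := linear_D (chi_r_hom g).1.
Let lL := (chi_l_hom g).2.
Let rL := (chi_r_hom g).2.

Lemma anti_linear : linear anti.
Proof.
by move=> c x y; rewrite /anti (chi_l_hom g).1 (chi_r_hom g).1 scalerBr; abel.
Qed.

Lemma lie_lr x y : lie (l x) (r y) = lie (r x) (l y).
Proof.
have := chi_comm (x + y); rewrite lD rD lieDl !lieDr !chi_comm add0r addr0 => /eqP.
by rewrite addr_eq0 => /eqP->; rewrite -lieNC.
Qed.

Lemma lie_sym_anti x y : lie (l x + r x) (anti y) = anti (lie x y).
Proof. by rewrite /anti lL rL lieDl !lieBr lie_lr; abel. Qed.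

Lemma lie_anti2 x y : lie (anti x) (anti y) =
  (l (lie x y) + r (lie x y)) + (l (lie x y) + r (lie x y))
  - lie (l x + r x) (l y + r y).
Proof.
by rewrite /anti lL rL lieBl lieDl !lieBr !lieDr lie_lr; abel.
Qed.

Lemma lie_l_anti x y :
  lie (l x) (anti y) + lie (l x) (anti y) = lie (anti x) (anti y) + anti (lie x y).
Proof. by rewrite /anti lL rL lieBl !lieBr lie_lr; abel. Qed.

(** On antisymmetric elements x + x' acts by ad x, and [x - x', y - y'] differs
    from an element of the form z + z' by the bracket of two such elements; this
    makes x |-> x - x' a morphism of Lie triple systems. *)
Lemma anti_triple x y z : anti (lie x (lie y z)) = lie (anti x) (lie (anti y) (anti z)).
Proof.
rewrite lie_anti2 lieBr lieDr (lieNC (anti x) (_ + _)) (lieNC (anti x) (lie _ _)).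
rewrite lie_ad !lie_sym_anti -(linear_B (@anti_linear)) -lie_ad.
by rewrite (lieNC _ x) (linear_N (@anti_linear)); abel.
Qed.

Lemma rlie_anti (s : seq g) : odd (size s) -> rlie (map anti s) = anti (rlie s).
Proof.
have [n] := ubnP (size s); elim: n s => // n IH [|x [|y [|z s]]] // hn ho.
rewrite 2!map_cons (rlie_cons (anti x)) // (rlie_cons (anti y)) //.
by rewrite IH -?anti_triple //; move: hn ho => /=; lia.
Qed.

End AntisymmetricElements.

Section PresentationToChi.
Variables (K : fieldType) (m : nat).
Local Notation g := (free_lie K 'I_m).
Local Notation L := (calL K m).
Hypothesis K2 : 2%N \notin [pchar K].

Lemma calL_to_chi : exists theta : L -> chi g,
  [/\ lie_hom theta, forall i, theta (gen_a i) = anti (free_gen i)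
    & forall i j, theta (gen_b i j) = anti (lie (free_gen i) (free_gen j))].
Proof.
apply: (calL_ext (f := fun w => anti (rlie (map free_gen w)))) => [i|i j|u].
- by rewrite lie_alt (linear_0 (anti_linear (g := g))).
- by rewrite (lieNC (free_gen j)) (linear_N (anti_linear (g := g))).
apply: (rl_ev_plain (n := count is_b u)) => // {}u pu _; rewrite wt_plain // => ou.
rewrite -(ev_morph (h := @anti K g)); last exact: linear_B (anti_linear (g := g)).
rewrite -rl_ev_lie -rlie_anti ?size_map // -map_comp.
congr rlie; elim: u pu {ou} => // l u IH; rewrite plain_cons => /andP[pl pu] /=.
by rewrite IH //; case: l pl => [i|[] i j].
Qed.

Lemma calL_to_chi_act (d : lieAction g L) (theta : L -> chi g) :
  prescribed_action d -> lie_hom theta ->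
  (forall i, theta (gen_a i) = anti (free_gen i)) ->
  (forall i j, theta (gen_b i j) = anti (lie (free_gen i) (free_gen j))) ->
  forall x k, theta (d x k) = lie (chi_l x) (theta k).
Proof.
move=> [da db] [lt mt] ta tb.
have [ll ml] := chi_l_hom g.
apply: free_lie_ind => [|s].
  split=> [k|x y hx hy k|c x hx k|x y hx hy k].
  - by rewrite (linear_0 (act_linearl d k)) (linear_0 ll) lie0l linear_0.
  - by rewrite (linear_D (act_linearl d k)) (linear_D lt) (linear_D ll) lieDl hx hy.
  - by rewrite (linear_Z (act_linearl d k)) (linear_Z lt) (linear_Z ll) lieZl hx.
  - by rewrite act_lie (linear_B lt) !hx !hy hx ml lie_ad.
apply: calL_ind => [|i|i j].
- split=> [|x y hx hy|c x hx|x y hx hy].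
  + by rewrite (linear_0 (act_linearr d _)) (linear_0 lt) lie0r.
  + by rewrite (linear_D (act_linearr d _)) !(linear_D lt) lieDr hx hy.
  + by rewrite (linear_Z (act_linearr d _)) !(linear_Z lt) lieZr hx.
  + by rewrite act_derivation (linear_D lt) !mt hx hy (derivation_ad (chi_l _)).2.
- rewrite da (linear_Z lt) (linear_D lt) mt !ta tb -lie_l_anti.
  by rewrite scalerDr half_dbl.
rewrite db (linear_Z lt) (linear_D lt) /= !mt !ta tb -anti_triple -lie_l_anti.
by rewrite scalerDr half_dbl.
Qed.

End PresentationToChi.

(** * Lifts of the identity to a semidirect product *)

Section Twist.
Variables (K : fieldType) (g L : lieAlgType K) (d : lieAction g L) (alpha : g -> L).
Hypothesis alpha_lin : linear alpha.
Hypothesis alpha_lie : forall x y,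
  alpha (lie x y) = d x (alpha y) - d y (alpha x) - lie (alpha x) (alpha y).

(** The action of x + x' on [L], where x' = x - alpha x; that x |-> x' is a
    morphism to the semidirect product is what [alpha_lie] expresses. *)
Definition twist (x : g) (k : L) : L := d x k + d x k - lie (alpha x) k.

Lemma twist_linearl k : linear (twist^~ k).
Proof.
move=> c x y; rewrite /twist act_linearl alpha_lin lie_linearl !scalerDr scalerN.
abel.
Qed.

Lemma twist_derivation x : derivation (twist x).
Proof.
split=> [c k k'|k k']; rewrite /twist.
  by rewrite act_linearr lie_linearr !scalerDr scalerN; abel.
by rewrite act_derivation (derivation_ad (alpha x)).2 !lieDl !lieDr lieNl lieNr; abel.
Qed.

Lemma act_twist x k : d x k + d x k = twist x k + lie (alpha x) k.
Proof. by rewrite /twist; abel. Qed.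

Lemma alpha_twist x y : alpha (lie x y) + alpha (lie x y) =
  twist x (alpha y) - twist y (alpha x).
Proof. by rewrite /twist alpha_lie (lieNC (alpha y)); abel. Qed.

Lemma twist_lie x y k : twist (lie x y) k + twist (lie x y) k =
  twist x (twist y k) - twist y (twist x k) + lie (lie (alpha x) (alpha y)) k.
Proof.
have [[lx mx] [ly my]] := (twist_derivation x, twist_derivation y).
(* d is known through the twist only after doubling, and it occurs twice *)
have dd u v : d u (d v k) + d u (d v k) + (d u (d v k) + d u (d v k)) =
    twist u (twist v k + lie (alpha v) k) + lie (alpha u) (twist v k + lie (alpha v) k).
  by rewrite -act_twist -act_twist actD; abel.
have hd : twist (lie x y) k + twist (lie x y) k =
    (d (lie x y) k + d (lie x y) k) + (d (lie x y) k + d (lie x y) k)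
    - lie (alpha (lie x y) + alpha (lie x y)) k.
  by rewrite lieDl /twist; abel.
transitivity ((d x (d y k) + d x (d y k) + (d x (d y k) + d x (d y k)))
  - (d y (d x k) + d y (d x k) + (d y (d x k) + d y (d x k)))
  - lie (alpha (lie x y) + alpha (lie x y)) k).
  by rewrite hd act_lie; abel.
rewrite !dd alpha_twist lieBl (linear_D lx) (linear_D ly) mx my !lieDr.
by rewrite (lie_ad (alpha x)); abel.
Qed.

End Twist.

(** * The isomorphism *)

Section Isomorphism.
Variables (K : fieldType) (m : nat).
Local Notation g := (free_lie K 'I_m).
Local Notation L := (calL K m).
Local Notation nform := (@nform K m).
Local Notation X w := (rlie (map (@free_gen K 'I_m) w)).
Hypothesis K2 : 2%N \notin [pchar K].

Lemma action_derivation (h M : lieAlgType K) (d : lieAction h M) x : derivation (d x).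
Proof. by split=> [|k k']; [exact: act_linearr|exact: act_derivation]. Qed.

Lemma prescribed_action_unique (d d' : lieAction g L) :
  prescribed_action d -> prescribed_action d' -> d' =2 d.
Proof.
move=> [da db] [da' db'].
apply: free_lie_ind => [|s].
  split=> [k|x y hx hy k|c x hx k|x y hx hy k].
  - by rewrite !(linear_0 (act_linearl _ k)).
  - by rewrite !(linear_D (act_linearl _ k)) hx hy.
  - by rewrite !(linear_Z (act_linearl _ k)) hx.
  - by rewrite !act_lie !hx !hy ?hx.
apply: calL_ind => [|i|i j]; last 2 first.
- by rewrite da da'.
- by rewrite db db'.
exact: derivation_eq_stable (action_derivation d' _) (action_derivation d _).
Qed.

(** The derivations x_s |-> (ad a_s + D_s) / 2. *)
Lemma prescribed_action_exists : exists d : lieAction g L, prescribed_action d.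
Proof.
have [D DP] := choice (@shift_exists K m).
have der s : derivation (fun k => 2%:R^-1 *: lie (gen_a s) k + 2%:R^-1 *: D s k).
  by have [derD _ _ _] := DP s; apply: derivation_comb (derivation_ad _) derD.
exists (free_action der); split=> [s i|s i j]; have [_ Da Db _] := DP s.
  by rewrite free_action_gen Da scalerDr.
by rewrite free_action_gen Db scalerDr.
Qed.

Section Action.
Variable d : lieAction g L.
Hypothesis dP : prescribed_action d.
Local Notation S := (semidirect d).

Definition psi : g -> S := free_ext (fun i => (- gen_a i, free_gen i) : S).

Lemma psi_hom : lie_hom psi.
Proof. exact: free_ext_hom. Qed.

Lemma psi_gen i : psi (free_gen i) = (- gen_a i, free_gen i).
Proof. exact: free_ext_gen. Qed.

Lemma psi_snd x : (psi x).2 = x.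
Proof.
have snd_hom : lie_hom (snd : S -> g) by split.
move: x; apply: free_lie_ind => [|i]; last by rewrite psi_gen.
exact: hom_eq_stable (hom_comp psi_hom snd_hom) (id_hom g).
Qed.

Definition alpha (x : g) : L := - (psi x).1.

Lemma psiE x : psi x = (- alpha x, x) :> L * g.
Proof. by rewrite [LHS]surjective_pairing psi_snd /alpha opprK. Qed.

Lemma alpha_linear : linear alpha.
Proof. by move=> c x y; rewrite /alpha psi_hom.1 /= scalerN opprD. Qed.

Lemma alpha_lie x y :
  alpha (lie x y) = d x (alpha y) - d y (alpha x) - lie (alpha x) (alpha y).
Proof.
rewrite {1}/alpha psi_hom.2 !psiE /= lieNl lieNr.
by rewrite !(linear_N (act_linearr d _)); abel.
Qed.

Lemma alpha_gen i : alpha (free_gen i) = gen_a i.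
Proof. by rewrite /alpha psi_gen opprK. Qed.

Local Notation sigma := (twist d alpha).
Let sigma_lin := twist_linearl d alpha_linear.
Let sigma_der := twist_derivation d alpha.

Lemma sigma_gen_exists : exists D : 'I_m -> L -> L,
  [/\ forall s, sigma (free_gen s) =1 D s,
      forall s i, D s (gen_a i) = gen_b s i,
      forall s i j, D s (gen_b i j) = rlie [:: gen_a s; gen_a i; gen_a j]
    & forall s w, w != [::] -> D s (nform w) = nform (s :: w)].
Proof.
have [D DP] := choice (@shift_exists K m).
exists D; split=> [s|s i|s i j|s w]; have [derD Da Db Dn] := DP s.
- apply: calL_ind => [|i|i j].
  + exact: derivation_eq_stable (sigma_der _) derD.
  + rewrite /twist dP.1 Da half_dbl // alpha_gen; abel.
  + rewrite /twist dP.2 Db half_dbl // alpha_gen; abel.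
- exact: Da.
- exact: Db.
- exact: Dn.
Qed.

Lemma free_cons i (w : seq 'I_m) : w != [::] ->
  X (i :: w) = lie (free_gen i) (X w).
Proof. by move=> w0; rewrite map_cons rlie_cons //; case: (w) w0. Qed.

Lemma sigma_inner i z k :
  sigma (free_gen i) (sigma z k) - sigma z (sigma (free_gen i) k) =
    lie (lie (gen_a i) (alpha z)) k ->
  sigma (lie (free_gen i) z) k = lie (lie (gen_a i) (alpha z)) k.
Proof.
move=> comm; apply: (dbl_inj K2).
by rewrite (twist_lie alpha_lie) comm alpha_gen.
Qed.

(** The three statements need each other: the commutator makes sigma of the next
    longer bracket inner, by [sigma_inner]; the second one is then immediate, and
    together with the first it yields the next value of alpha. The commutator
    with an inner derivation is inner, and identified by centrality. *)
Lemma sigma_word t w : w != [::] ->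
  [/\ alpha (X w) = nform w, sigma (X w) (gen_a t) = - nform (t :: w)
    & forall k, sigma (free_gen t) (sigma (X w) k) - sigma (X w) (sigma (free_gen t) k)
        = lie (lie (gen_a t) (nform w)) k].
Proof.
have [D [sD Da Db Dn]] := sigma_gen_exists.
have derD s : derivation (D s).
  by split=> [c x y|x y]; rewrite -!sD ?(sigma_der _).1 ?(sigma_der _).2.
elim: w t => // i w IH t _.
have [->{IH}|w0] := eqVneq w [::].
  split=> [||k]; rewrite /= ?alpha_gen ?sD //.
    by rewrite Da gen_b_anti.
  move: k; apply: calL_ind => [|j|j k].
  - exact: derivation_eq_stable (derivation_comm (derD t) (derD i)) (derivation_ad _).
  - by rewrite !Da !Db lie_ad.
  - by rewrite !(Dn _ [:: j; k]) // !Dn // lie_ad.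
have [aw sw cw] := IH i w0.
have sX k : sigma (X (i :: w)) k = lie (lie (gen_a i) (nform w)) k.
  by rewrite free_cons // sigma_inner aw.
split=> [||k].
- apply: (dbl_inj K2); rewrite free_cons // (alpha_twist alpha_lie).
  by rewrite aw alpha_gen sw sD Dn // opprK.
- by rewrite sX lieNC nform_cons2.
rewrite !sX !sD (derD t).2 addrK; rewrite (derD t).2 Da Dn //.
by rewrite lieNC lieDr nform_central // -lieNC.
Qed.

Lemma sigma_alpha x y : sigma x (alpha y) = alpha (lie x y).
Proof.
have [D [sD Da Db Dn]] := sigma_gen_exists.
have la := alpha_linear.
have gen_y i z : sigma (free_gen i) (alpha z) = alpha (lie (free_gen i) z).
  rewrite sD; have lD : linear (D i).
    by move=> c u v; rewrite -!sD (sigma_der _).1.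
  move: z; apply: free_rlie_ind => [|u v hu hv|c u hu|w].
  - by rewrite lie0r !(linear_0 la) linear_0.
  - by rewrite lieDr !(linear_D la) (linear_D lD) hu hv.
  - by rewrite lieZr !(linear_Z la) (linear_Z lD) hu.
  have [->|w0] := eqVneq w [::]; first by rewrite lie0r !(linear_0 la) linear_0.
  have [-> _ _] := sigma_word i w0.
  rewrite Dn // -free_cons //.
  by have [<- _ _] := @sigma_word i (i :: w) isT.
move: x y; apply: free_rlie_ind => [y|u v hu hv y|c u hu y|w].
- by rewrite (linear_0 (sigma_lin _)) lie0l linear_0.
- by rewrite (linear_D (sigma_lin _)) hu hv lieDl (linear_D la).
- by rewrite (linear_Z (sigma_lin _)) hu lieZl (linear_Z la).
elim: w => [|i w IH] y; first by rewrite (linear_0 (sigma_lin _)) lie0l linear_0.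
have [->|w0] := eqVneq w [::]; first exact: gen_y.
have [aw sw cw] := sigma_word i w0.
rewrite free_cons // sigma_inner ?aw ?cw // -cw.
by rewrite IH !gen_y IH lie_ad (linear_B la).
Qed.

Lemma act_alpha x : d x (alpha x) = 0.
Proof.
apply: (dbl_inj K2); rewrite (act_twist d alpha) sigma_alpha !lie_alt.
by rewrite (linear_0 alpha_linear).
Qed.

Lemma chi_isomorphic : lie_isomorphic (chi g) (semidirect d).
Proof.
pose j (x : g) : S := (0, x).
have j_hom : lie_hom j.
  split=> [c x y|x y]; congr pair => /=; first by rewrite scaler0 addr0.
  by rewrite lie0l !(linear_0 (act_linearr d _)); abel.
have j_psi x : lie (j x) (psi x) = 0.
  rewrite psiE; congr pair => /=; last exact: lie_alt.
  rewrite lie0l (linear_N (act_linearr d _)) act_alpha.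
  by rewrite (linear_0 (act_linearr d _)); abel.
have [F [F_hom Fl Fr]] := chi_ext j_hom psi_hom j_psi.
have [theta [t_hom ta tb]] := calL_to_chi K m.
have t_act := calL_to_chi_act K2 dP t_hom ta tb.
pose G (p : S) : chi g := theta p.1 + chi_l p.2.
have [l_lin l_lie] := chi_l_hom g.
have G_hom : lie_hom G.
  split=> [c p q|p q]; rewrite /G /=.
    by rewrite t_hom.1 l_lin scalerDr; abel.
  rewrite (linear_B t_hom.1) (linear_D t_hom.1) t_hom.2 l_lie !t_act.
  by rewrite lieDl !lieDr (lieNC (theta p.1) (chi_l _)); abel.
have F_anti x : F (anti x) = (alpha x, 0) :> L * g.
  rewrite /anti (linear_B F_hom.1) Fl Fr psiE.
  by congr pair; rewrite /= ?subrr // sub0r opprK.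
have alpha_b i1 i2 : alpha (lie (free_gen i1) (free_gen i2)) = gen_b i1 i2.
  by have [] := @sigma_word i1 [:: i1; i2] isT.
have inl_hom : lie_hom (fun k => (k, 0) : S).
  split=> [c x y|x y]; congr pair => /=; rewrite ?scaler0 ?addr0 ?lie_alt //.
  by rewrite !(linear_0 (act_linearl d _)); abel.
have F_theta k : F (theta k) = (k, 0).
  move: k; apply: calL_ind => [|i|i1 i2].
  - exact: hom_eq_stable (hom_comp t_hom F_hom) inl_hom.
  - by rewrite ta F_anti alpha_gen.
  - by rewrite tb F_anti alpha_b.
have G_psi x : G (psi x) = chi_r x.
  move: x; apply: free_lie_ind => [|i].
    exact: hom_eq_stable (hom_comp psi_hom G_hom) (chi_r_hom g).
  by rewrite psi_gen /G /= (linear_N t_hom.1) ta /anti; abel.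
exists F => //; exists G => [z|p].
  move: z; apply: chi_ind => [|x|x].
  - exact: hom_eq_stable (hom_comp F_hom G_hom) (id_hom _).
  - by rewrite Fl /G /= (linear_0 t_hom.1) add0r.
  - by rewrite Fr G_psi.
rewrite /G (linear_D F_hom.1) F_theta Fl [RHS]surjective_pairing.
by congr pair; rewrite /= ?addr0 ?add0r.
Qed.

End Action.

End Isomorphism.

Theorem theorem3p8 (K : fieldType) (charK : 2%N \notin [pchar K]) (m : nat) :
  exists d : lieAction (free_lie K 'I_m) (calL K m),
    [/\ prescribed_action d,
        (forall d' : lieAction (free_lie K 'I_m) (calL K m),
           prescribed_action d' -> d' =2 d)
      & lie_isomorphic (chi (free_lie K 'I_m)) (semidirect d)].
Proof.
have [d dP] := prescribed_action_exists K m.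
exists d; split=> [//|d' d'P|]; first exact: prescribed_action_unique dP d'P.
exact (chi_isomorphic charK dP).
Qed.
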